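(* Let $n$ be a positive integer divisible by $3$. For every $[m,f]\in\mathsf{GT}(\mathsf{K}^{(n)})$ there exist $g,h\in\mathsf{F}_2$ such that $$ f\,\mathsf{K}^{(n)}_{\mathsf{F}_2}=\theta(g)^{-1}g\,\mathsf{K}^{(n)}_{\mathsf{F}_2},\qquad fx^m\,\mathsf{K}^{(n)}_{\mathsf{F}_2}=\begin{cases}\tau(h)^{-1}h\,\mathsf{K}^{(n)}_{\mathsf{F}_2}&\text{if }m\equiv0\bmod3,\\ \tau(h)^{-1}xy\,h\,\mathsf{K}^{(n)}_{\mathsf{F}_2}&\text{if }m\equiv-1\bmod3,\end{cases} $$ where $\theta$ and $\tau$ are the automorphisms of $\mathsf{F}_2=\langle x,y\rangle$ given by $\theta(x)=y$, $\theta(y)=x$ and $\tau(x)=y$, $\tau(y)=y^{-1}x^{-1}$.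
   Context: **Braid groups.** $\mathrm{B}_3=\langle \sigma_1,\sigma_2\mid \sigma_1\sigma_2\sigma_1=\sigma_2\sigma_1\sigma_2\rangle$; $\mathrm{PB}_3$ is the kernel of the standard homomorphism $\mathrm{B}_3\to S_3$; $x_{12}:=\sigma_1^2$, $x_{23}:=\sigma_2^2$, $c:=(\sigma_1\sigma_2\sigma_1)^2$. One has $\mathrm{PB}_3=\langle x_{12},x_{23}\rangle\times\langle c\rangle$ with $\langle x_{12},x_{23}\rangle$ free; $\mathsf{F}_2$ denotes the subgroup $\langle x_{12},x_{23}\rangle$, with $x:=x_{12}$, $y:=x_{23}$. $\mathsf{NFI}_{\mathrm{PB}_3}(\mathrm{B}_3)$ is the set of finite index normal subgroups $\mathsf{N}\unlhd\mathrm{B}_3$ with $\mathsf{N}\le\mathrm{PB}_3$. For such $\mathsf{N}$: $\mathsf{N}_{\mathsf{F}_2}:=\mathsf{N}\cap\mathsf{F}_2$, and $N_{\mathrm{ord}}$ is the lcm of the orders of $x_{12}\mathsf{N}$, $x_{23}\mathsf{N}$, $c\mathsf{N}$ in $\mathrm{PB}_3/\mathsf{N}$. **$\mathsf{GT}$-shadows.** For $(m,f)\in\mathbb{Z}\times\mathsf{F}_2$, $[m,f]:=(m+N_{\mathrm{ord}}\mathbb{Z}, f\mathsf{N}_{\mathsf{F}_2})$. $\mathsf{GT}(\mathsf{N})$ is the set of those $[m,f]\in\mathbb{Z}/N_{\mathrm{ord}}\mathbb{Z}\times\mathsf{F}_2/\mathsf{N}_{\mathsf{F}_2}$ such that: (i)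 the hexagon relations hold: $\sigma_1^{2m+1}f^{-1}\sigma_2^{2m+1}f\,\mathsf{N}=f^{-1}\sigma_1\sigma_2x_{12}^{-m}c^m\,\mathsf{N}$ and $f^{-1}\sigma_2^{2m+1}f\sigma_1^{2m+1}\,\mathsf{N}=\sigma_2\sigma_1x_{23}^{-m}c^mf\,\mathsf{N}$; (ii) $\gcd(2m+1,N_{\mathrm{ord}})=1$ and $f\mathsf{N}_{\mathsf{F}_2}\in[\mathsf{F}_2/\mathsf{N}_{\mathsf{F}_2},\mathsf{F}_2/\mathsf{N}_{\mathsf{F}_2}]$; (iii) the homomorphism $T_{m,f}:\mathrm{B}_3\to\mathrm{B}_3/\mathsf{N}$, $\sigma_1\mapsto\sigma_1^{2m+1}\mathsf{N}$, $\sigma_2\mapsto f^{-1}\sigma_2^{2m+1}f\,\mathsf{N}$ (well defined by (i)), is surjective. **The subgroups $\mathsf{K}^{(n)}$.** For an integer $n\ge3$ let $D_n=\langle r,s\mid r^n,s^2,srs^{-1}r\rangle$, and let $\psi_n:\mathrm{PB}_3\to D_n^3$ be the homomorphism $\psi_n(x_{12})=(r,s,s)$, $\psi_n(x_{23})=(rs,r,rs)$, $\psi_n(c)=(1,1,1)$. Set $\mathsf{K}^{(n)}:=\ker\psi_n$, which is an element of $\mathsf{NFI}_{\mathrm{PB}_3}(\mathrm{B}_3)$, with $K^{(n)}_{\mathrm{ord}}=\mathrm{lcm}(n,2)$. (When $3\mid n$, $3$ divides $K^{(n)}_{\mathrm{ord}}$, so $m\bmod 3$ is well defined, and $\gcd(2m+1,K^{(n)}_{\mathrm{ord}})=1$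 excludes $m\equiv1\bmod 3$.) *)

(* Defs.v *)
From HB Require Import structures.
From mathcomp Require Import all_boot all_order all_algebra.
From mathcomp Require Import perm.
From mathcomp Require Import boolp classical_sets.

Set Implicit Arguments.
Unset Strict Implicit.
Unset Printing Implicit Defensive.

Local Open Scope group_scope.
Local Open Scope quotient_scope.
Local Open Scope classical_set_scope.

Definition expgz (G : groupType) (x : G) (m : int) : G :=
  match m with Posz k => x ^+ k | Negz k => x ^- k.+1 end.

(* 0 when x has infinite order *)
Definition ordg (G : groupType) (x : G) : nat :=
  match pselect (exists k, (0 < k)%N && (x ^+ k == 1)) with
  | left ex => ex_minn ex
  | right _ => 0%N
  end.

Definition commutator_subgroup (G : groupType) : set G :=
  [set z | forall H : {pred G}, group_closed H ->
             (forall a b : G, [~ a, b] \in H) -> z \in H].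

Record normalSub (G : groupType) := NormalSub {
  normal_pred :> {pred G};
  normal_group : group_closed normal_pred;
  normal_conj : forall x y : G, x \in normal_pred -> x ^ y \in normal_pred }.

Section Quotient.
Variables (G : groupType) (N : normalSub G).

Definition cosetr : rel G := fun x y => x^-1 * y \in N.

Lemma nsub1 : 1 \in N. Proof. by case: (normal_group N). Qed.
Lemma nsubV x : x \in N -> x^-1 \in N.
Proof. exact: group_closedV (normal_group N) x. Qed.
Lemma nsubM x y : x \in N -> y \in N -> x * y \in N.
Proof. exact: (group_closedM (normal_group N)). Qed.

Lemma cosetr_is_equiv : equiv_class_of cosetr.
Proof.
split=> [x|x y|y x z]; rewrite /cosetr ?mulVg ?nsub1 //.
  by apply/idP/idP => /nsubV; rewrite invgM invgK.
by move=> h1 h2; have := nsubM h1 h2; rewrite -mulgA mulVKg.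
Qed.

Canonical cosetr_equiv := EquivRelPack cosetr_is_equiv.

Definition quo := {eq_quot cosetr}.
HB.instance Definition _ := Choice.on quo.
HB.instance Definition _ := EqQuotient.on quo.

Definition cls (x : G) : quo := \pi_quo x.

Lemma clsE x y : (cls x = cls y) <-> (x^-1 * y \in N).
Proof. by split=> [/eqmodP|h]; last apply/eqmodP. Qed.

Lemma cls_repr (a : quo) : cls (repr a) = a.
Proof. exact: reprK. Qed.

Definition quo_mul (a b : quo) : quo := cls (repr a * repr b).
Definition quo_inv (a : quo) : quo := cls (repr a)^-1.

Lemma quo_mulE x y : quo_mul (cls x) (cls y) = cls (x * y).
Proof.
apply/clsE; have /clsE hx := cls_repr (cls x); have /clsE hy := cls_repr (cls y).
have := nsubM (normal_conj (repr (cls y)) hx) hy.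
by rewrite conjgE !invgM !mulgA mulgK.
Qed.

Lemma quo_invE x : quo_inv (cls x) = cls x^-1.
Proof.
apply/clsE; have /clsE hx := cls_repr (cls x).
have := normal_conj x^-1 (nsubV hx).
by rewrite conjgE invgM !invgK !mulgA mulgV mul1g.
Qed.

Lemma quo_mulA : associative quo_mul.
Proof.
move=> a b c; rewrite -(cls_repr a) -(cls_repr b) -(cls_repr c).
by rewrite !quo_mulE mulgA.
Qed.
Lemma quo_mul1 : left_id (cls 1) quo_mul.
Proof. by move=> a; rewrite -(cls_repr a) quo_mulE mul1g. Qed.
Lemma quo_mulr1 : right_id (cls 1) quo_mul.
Proof. by move=> a; rewrite -(cls_repr a) quo_mulE mulg1. Qed.
Lemma quo_mulV : left_inverse (cls 1) quo_inv quo_mul.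
Proof. by move=> a; rewrite -(cls_repr a) quo_invE quo_mulE mulVg. Qed.
Lemma quo_mulrV : right_inverse (cls 1) quo_inv quo_mul.
Proof. by move=> a; rewrite -(cls_repr a) quo_invE quo_mulE mulgV. Qed.

HB.instance Definition _ :=
  isGroup.Build quo quo_mulA quo_mul1 quo_mulr1 quo_mulV quo_mulrV.

Lemma cls_is_morphism : monoid_morphism cls.
Proof. by split=> // x y; rewrite -quo_mulE. Qed.
HB.instance Definition _ := isUMagmaMorphism.Build G quo cls cls_is_morphism.

End Quotient.

(* Finitely presented groups: words in k letters and their inverses (the      *)
(* boolean of a letter tells whether it is inverted), modulo the relators R.  *)

Definition word k := seq ('I_k * bool).

Definition wletter_inv k (l : 'I_k * bool) : 'I_k * bool := (l.1, ~~ l.2).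
Definition winv k (w : word k) : word k := rev (map (@wletter_inv k) w).

Inductive weq k (R : seq (word k)) : word k -> word k -> Prop :=
| weq_refl w : weq R w w
| weq_sym w w' : weq R w w' -> weq R w' w
| weq_trans w w' w'' : weq R w w' -> weq R w' w'' -> weq R w w''
| weq_cancel u l v : weq R (u ++ l :: wletter_inv l :: v) (u ++ v)
| weq_relator u r v : r \in R -> weq R (u ++ r ++ v) (u ++ v).

Section Presented.
Variables (k : nat) (R : seq (word k)).
Implicit Types (w u v : word k) (l : 'I_k * bool).

Definition weqb : rel (word k) := fun w w' => `[< weq R w w' >].

Lemma weqb_is_equiv : equiv_class_of weqb.
Proof.
split=> [w|w w'|w' w w'']; first exact/asboolP/weq_refl.
  by apply/asboolP/asboolP => h; apply: weq_sym.
by move=> /asboolP h1 /asboolP h2; apply/asboolP/(weq_trans h1 h2).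
Qed.
Canonical weqb_equiv := EquivRelPack weqb_is_equiv.

Definition pres := {eq_quot weqb}.
HB.instance Definition _ := Choice.on pres.
HB.instance Definition _ := EqQuotient.on pres.

Definition wcls w : pres := \pi_pres w.

Lemma wclsE w w' : wcls w = wcls w' <-> weq R w w'.
Proof.
by split=> [/eqmodP/asboolP //|h]; apply/eqmodP/asboolP.
Qed.
Lemma wcls_repr (a : pres) : wcls (repr a) = a. Proof. exact: reprK. Qed.

Lemma weq_catl w u v : weq R u v -> weq R (w ++ u) (w ++ v).
Proof.
elim=> [?|? ? _ /weq_sym //|? ? ? _ h1 _ h2|u' l v'|u' r v' hr];
  [exact: weq_refl|exact: weq_trans h1 h2| |]; rewrite !catA.
  exact: weq_cancel.
by rewrite -!catA !(catA w); apply: weq_relator.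
Qed.

Lemma weq_catr w u v : weq R u v -> weq R (u ++ w) (v ++ w).
Proof.
elim=> [?|? ? _ /weq_sym //|? ? ? _ h1 _ h2|u' l v'|u' r v' hr];
  [exact: weq_refl|exact: weq_trans h1 h2| |]; rewrite -!catA.
  exact: weq_cancel.
exact: weq_relator.
Qed.

Lemma wletter_invK l : wletter_inv (wletter_inv l) = l.
Proof. by case: l => i b; rewrite /wletter_inv /= negbK. Qed.

Lemma winvK w : winv (winv w) = w.
Proof.
by rewrite /winv map_rev revK -map_comp map_id_in // => l _; exact: wletter_invK.
Qed.

Lemma weq_winvr w : weq R (w ++ winv w) [::].
Proof.
elim: w => [|l w IH]; first exact: weq_refl.
rewrite /winv /= rev_cons -cats1 -/(winv w) catA.
apply: weq_trans (weq_cancel R [::] l [::]).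
exact: (weq_catl [:: l] (weq_catr [:: wletter_inv l] IH)).
Qed.

Lemma weq_winvl w : weq R (winv w ++ w) [::].
Proof. by rewrite -{2}(winvK w); apply: weq_winvr. Qed.

Lemma weq_winv u v : weq R u v -> weq R (winv u) (winv v).
Proof.
move=> h; apply: (@weq_trans _ _ _ (winv u ++ v ++ winv v)).
  by rewrite -{1}(cats0 (winv u)); apply/weq_catl/weq_sym/weq_winvr.
rewrite catA -{2}(cat0s (winv v)); apply: weq_catr.
apply: weq_trans (weq_winvl u); apply: weq_catl; exact: weq_sym.
Qed.

Definition pres_mul (a b : pres) : pres := wcls (repr a ++ repr b).
Definition pres_inv (a : pres) : pres := wcls (winv (repr a)).

Lemma pres_mulE u v : pres_mul (wcls u) (wcls v) = wcls (u ++ v).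
Proof.
have /wclsE hu := wcls_repr (wcls u); have /wclsE hv := wcls_repr (wcls v).
by apply/wclsE; apply: weq_trans (weq_catr _ hu) (weq_catl _ hv).
Qed.
Lemma pres_invE u : pres_inv (wcls u) = wcls (winv u).
Proof. by apply/wclsE/weq_winv/wclsE/wcls_repr. Qed.

Lemma pres_mulA : associative pres_mul.
Proof.
move=> a b c; rewrite -(wcls_repr a) -(wcls_repr b) -(wcls_repr c).
by rewrite !pres_mulE catA.
Qed.
Lemma pres_mul1 : left_id (wcls [::]) pres_mul.
Proof. by move=> a; rewrite -(wcls_repr a) pres_mulE. Qed.
Lemma pres_mulr1 : right_id (wcls [::]) pres_mul.
Proof. by move=> a; rewrite -(wcls_repr a) pres_mulE cats0. Qed.
Lemma pres_mulV : left_inverse (wcls [::]) pres_inv pres_mul.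
Proof.
move=> a; rewrite -(wcls_repr a) pres_invE pres_mulE; exact/wclsE/weq_winvl.
Qed.
Lemma pres_mulrV : right_inverse (wcls [::]) pres_inv pres_mul.
Proof.
move=> a; rewrite -(wcls_repr a) pres_invE pres_mulE; exact/wclsE/weq_winvr.
Qed.

HB.instance Definition _ :=
  isGroup.Build pres pres_mulA pres_mul1 pres_mulr1 pres_mulV pres_mulrV.

Definition pgen (i : 'I_k) : pres := wcls [:: (i, false)].

Definition weval (G : groupType) (a : 'I_k -> G) (w : word k) : G :=
  \prod_(l <- w) (if l.2 then (a l.1)^-1 else a l.1).

(* The homomorphism sending pgen i to a i; it is one as soon as the relators   *)
(* are killed (lift_morphism).                                                *)
Definition plift (G : groupType) (a : 'I_k -> G) (g : pres) : G :=
  weval a (repr g).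

Lemma wcls_cat u v : wcls (u ++ v) = wcls u * wcls v.
Proof. by rewrite -pres_mulE. Qed.
Lemma wcls_nil : wcls [::] = 1. Proof. by []. Qed.

Lemma wcls_letter l : wcls [:: l] = if l.2 then (pgen l.1)^-1 else pgen l.1.
Proof.
case: l => i [] //=; apply/esym/mulg1_eq; rewrite -wcls_cat.
exact/wclsE/(weq_cancel R [::] (i, false) [::]).
Qed.

Lemma pres_ind (P : pres -> Prop) :
  P 1 -> (forall g i, P g -> P (g * pgen i)) ->
  (forall g i, P g -> P (g * (pgen i)^-1)) -> forall g, P g.
Proof.
move=> h1 hM hV g; rewrite -(wcls_repr g).
elim/last_ind: (repr g) => [//|w [i b] IH].
by rewrite -cats1 wcls_cat wcls_letter; case: b; [apply: hV|apply: hM].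
Qed.

Lemma weval_cat (G : groupType) (a : 'I_k -> G) u v :
  weval a (u ++ v) = weval a u * weval a v.
Proof. by rewrite /weval big_cat. Qed.

Lemma wcls_weval w : wcls w = weval pgen w.
Proof.
elim: w => [|l w IH]; first by rewrite /weval big_nil.
by rewrite -cat1s wcls_cat IH wcls_letter /weval big_cons.
Qed.

Section Lift.
Variables (G : groupType) (a : 'I_k -> G).
Hypothesis aR : forall r, r \in R -> weval a r = 1.

Lemma weval_weq u v : weq R u v -> weval a u = weval a v.
Proof.
elim=> [?//|? ? _ -> //|? ? ? _ -> _ -> //|u' [i b] v'|u' r v' hr].
  rewrite !weval_cat; congr (_ * _); rewrite /weval !big_cons /=.
  by case: b => /=; rewrite ?mulVKg ?mulKg.
by rewrite !weval_cat (aR hr) mul1g.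
Qed.

Lemma lift_wcls w : plift a (wcls w) = weval a w.
Proof. by apply/weval_weq/wclsE/wcls_repr. Qed.

Lemma lift_morphism : monoid_morphism (plift a).
Proof.
split=> [|g h]; first by rewrite -wcls_nil lift_wcls /weval big_nil.
rewrite -(wcls_repr g) -(wcls_repr h) -wcls_cat !lift_wcls; exact: weval_cat.
Qed.

Lemma lift_gen i : plift a (pgen i) = a i.
Proof. by rewrite lift_wcls /weval big_seq1. Qed.
End Lift.

Lemma morphism_ext (G : groupType) (f1 f2 : UMagmaMorphism.type pres G) :
  (forall i, f1 (pgen i) = f2 (pgen i)) -> f1 =1 f2.
Proof.
move=> h; elim/pres_ind => [|g i IH|g i IH]; first by rewrite !gmulf1.
  by rewrite !gmulfM IH h.
by rewrite !gmulfF IH h.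
Qed.

End Presented.

Definition pair2 (T : Type) (a b : T) (i : 'I_2) : T :=
  if i == 0%N :> nat then a else b.

Definition i0 : 'I_2 := ord0.
Definition i1 : 'I_2 := ord_max.

Lemma I2E (i : 'I_2) : i = i0 \/ i = i1.
Proof. by case: i => [[|[|[]]] hi] //; [left|right]; apply/val_inj. Qed.

Definition braid_relator : word 2 :=
  [:: (i0, false); (i1, false); (i0, false);
      (i1, true); (i0, true); (i1, true)].

Definition B3 := pres [:: braid_relator].
HB.instance Definition _ := Group.on B3.

Definition s1 : B3 := pgen _ i0.
Definition s2 : B3 := pgen _ i1.
Definition x12 : B3 := s1 ^+ 2.
Definition x23 : B3 := s2 ^+ 2.
Definition cc : B3 := (s1 * s2 * s1) ^+ 2.

Definition ord3 (i : nat) : 'I_3 := inord i.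

Definition braid_perm : B3 -> 'S_3 :=
  plift (pair2 (tperm (ord3 0) (ord3 1)) (tperm (ord3 1) (ord3 2))).

Definition PB3 : {pred B3} := fun b => braid_perm b == 1.

(* The free group on x, y; it is identified with the subgroup <x12, x23> of   *)
(* B3 by means of the embedding iotaF (see iota_inj).                          *)
Definition F2 := pres (k := 2) [::].
HB.instance Definition _ := Group.on F2.

Definition x_F2 : F2 := pgen _ i0.
Definition y_F2 : F2 := pgen _ i1.

Definition iotaF : F2 -> B3 := plift (pair2 x12 x23).
Definition theta : F2 -> F2 := plift (pair2 y_F2 x_F2).
Definition tau : F2 -> F2 := plift (pair2 y_F2 (y_F2^-1 * x_F2^-1)).

Lemma free_lift_morphism (G : groupType) (a : 'I_2 -> G) :
  monoid_morphism (plift a : F2 -> G).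
Proof. exact: lift_morphism. Qed.
HB.instance Definition _ :=
  isUMagmaMorphism.Build F2 B3 iotaF (free_lift_morphism _).
HB.instance Definition _ :=
  isUMagmaMorphism.Build F2 F2 theta (free_lift_morphism _).
HB.instance Definition _ :=
  isUMagmaMorphism.Build F2 F2 tau (free_lift_morphism _).

Lemma iota_x : iotaF x_F2 = x12. Proof. exact: lift_gen. Qed.
Lemma iota_y : iotaF y_F2 = x23. Proof. exact: lift_gen. Qed.
Lemma theta_x : theta x_F2 = y_F2. Proof. exact: lift_gen. Qed.
Lemma theta_y : theta y_F2 = x_F2. Proof. exact: lift_gen. Qed.
Lemma tau_x : tau x_F2 = y_F2. Proof. exact: lift_gen. Qed.
Lemma tau_y : tau y_F2 = y_F2^-1 * x_F2^-1. Proof. exact: lift_gen. Qed.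

Lemma thetaK : involutive theta.
Proof.
move=> g; rewrite -[RHS]/(idfun g) -[LHS]/((theta \o theta) g).
apply: morphism_ext => i; case: (I2E i) => -> /=.
  by rewrite theta_x theta_y.
by rewrite theta_y theta_x.
Qed.

Lemma tauK g : tau (tau (tau g)) = g.
Proof.
have ty : tau (tau y_F2) = x_F2.
  by rewrite tau_y gmulfM !gmulfV /= tau_x tau_y invgM !invgK mulgK.
have tx : tau (tau (tau x_F2)) = x_F2 by rewrite tau_x.
have ty' : tau (tau (tau y_F2)) = y_F2 by rewrite ty tau_x.
rewrite -[RHS]/(idfun g) -[LHS]/((tau \o (tau \o tau)) g).
by apply: morphism_ext => i; case: (I2E i) => ->.
Qed.

(* The homomorphisms PB3 -> G killing cc. PB3 being the direct product of the *)
(* free group <x12, x23> and <cc>, there is exactly one such homomorphism     *)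
(* with x12 |-> u and x23 |-> v. It is obtained by the Schreier rewriting     *)
(* process for the transversal 1, s1, s2, s1 s2, s2 s1, s1 s2 s1 of PB3 in    *)
(* B3: schreier_next i t is the coset of t s_i, and schreier_coc i t is the   *)
(* image of t s_i (schreier_next i t)^-1.                                     *)
Inductive coset3 := C1 | Ca | Cb | Cab | Cba | Caba.

Definition schreier_next (i : 'I_2) (t : coset3) : coset3 :=
  pair2 match t with
        | C1 => Ca | Ca => C1 | Cb => Cba | Cba => Cb | Cab => Caba | Caba => Cab
        end
        match t with
        | C1 => Cb | Cb => C1 | Ca => Cab | Cab => Ca | Cba => Caba | Caba => Cba
        end i.

Section Schreier.
Variables (G : groupType) (u v : G).

Definition schreier_coc (i : 'I_2) (t : coset3) : G :=
  pair2 match t with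
        | Ca => u | Cba => u^-1 * v^-1 | Caba => v | _ => 1
        end
        match t with
        | Cb => v | Cab => v^-1 * u^-1 | Caba => u | _ => 1
        end i.

Definition schreier_step (p : G * coset3) (l : 'I_2 * bool) : G * coset3 :=
  let: (h, t) := p in let: (i, b) := l in
  let t' := schreier_next i t in
  (h * (if b then (schreier_coc i t')^-1 else schreier_coc i t), t').

Definition schreier_act (p : G * coset3) (b : B3) : G * coset3 :=
  foldl schreier_step p (repr b).

Definition schreier (b : B3) : G := (schreier_act (1, C1) b).1.

Lemma schreier_nextK i : involutive (schreier_next i).
Proof. by case: (I2E i) => ->; case. Qed.

Lemma schreier_stepK p l :
  schreier_step (schreier_step p l) (wletter_inv l) = p.
Proof.
by case: p l => h t [i []]; rewrite /= schreier_nextK -mulgA ?mulgV ?mulVg mulg1.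
Qed.

Lemma schreier_weq p w w' : weq [:: braid_relator] w w' ->
  foldl schreier_step p w = foldl schreier_step p w'.
Proof.
move=> h; elim: h p => [//|? ? _ IH p|? ? ? _ IH1 _ IH2 p|? l ? p|w1 r w2 hr p].
- by rewrite IH.
- by rewrite IH1.
- by rewrite !foldl_cat /= schreier_stepK.
rewrite !foldl_cat; set q := foldl _ p w1.
suff -> : foldl schreier_step q r = q by [].
move: hr; rewrite inE => /eqP ->; case: q => g t.
by case: t; rewrite /= /schreier_coc /pair2 /= ?(invgM, invg1, mulg1, mulgA, invgK,
  mulgK, mulgVK).
Qed.

Lemma schreier_act_wcls p w : schreier_act p (wcls _ w) = foldl schreier_step p w.
Proof. exact/schreier_weq/wclsE/wcls_repr. Qed.

Lemma schreier_actM p b b' :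
  schreier_act p (b * b') = schreier_act (schreier_act p b) b'.
Proof.
rewrite -(wcls_repr b) -(wcls_repr b') -wcls_cat !schreier_act_wcls.
exact: foldl_cat.
Qed.

Lemma schreier_act1 p : schreier_act p 1 = p.
Proof. by rewrite -(wcls_nil [:: braid_relator]) schreier_act_wcls. Qed.

Lemma schreier_act_gen p i : schreier_act p (pgen _ i) = schreier_step p (i, false).
Proof. exact: schreier_act_wcls. Qed.

Lemma schreier_act_genV p i :
  schreier_act p (pgen _ i)^-1 = schreier_step p (i, true).
Proof.
have /= <- := wcls_letter [:: braid_relator] (i, true).
exact: schreier_act_wcls.
Qed.

Definition schreier_actE := (schreier_actM, schreier_act1, schreier_act_genV,
  schreier_act_gen).

Lemma schreier_act_fst h g t b :
  schreier_act (h * g, t) b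
  = (h * (schreier_act (g, t) b).1, (schreier_act (g, t) b).2).
Proof.
elim/pres_ind: b => [|b i IH|b i IH]; first by rewrite !schreier_act1.
  rewrite !schreier_actM IH !schreier_act_gen.
  by case: (schreier_act (g, t) b) => h' t' /=; rewrite mulgA.
rewrite !schreier_actM IH !schreier_act_genV.
by case: (schreier_act (g, t) b) => h' t' /=; rewrite mulgA.
Qed.

Lemma schreier_act_snd g h t b :
  (schreier_act (g, t) b).2 = (schreier_act (h, t) b).2.
Proof.
by rewrite -(mulg1 g) -(mulg1 h) !schreier_act_fst.
Qed.

End Schreier.

Lemma braid_relator_perm r : r \in [:: braid_relator] ->
  weval (pair2 (tperm (ord3 0) (ord3 1)) (tperm (ord3 1) (ord3 2)) : 'I_2 -> 'S_3)
    r = 1.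
Proof.
rewrite inE => /eqP ->; rewrite /weval /braid_relator !big_cons big_nil /pair2 /=.
rewrite !tpermV mulg1; apply/permP => i; rewrite !permM perm1.
by rewrite !permE /= /ord3; apply/eqP; case: i => [[|[|[|]]] hi] //;
   rewrite -!val_eqE /= !inordK //= -!val_eqE /= !inordK.
Qed.

HB.instance Definition _ := isUMagmaMorphism.Build B3 'S_3 braid_perm
  (lift_morphism braid_relator_perm).

Lemma braid_perm_s1 : braid_perm s1 = tperm (ord3 0) (ord3 1).
Proof. exact: (lift_gen braid_relator_perm). Qed.
Lemma braid_perm_s2 : braid_perm s2 = tperm (ord3 1) (ord3 2).
Proof. exact: (lift_gen braid_relator_perm). Qed.

Lemma PB3_group : group_closed PB3.
Proof.
split; first by rewrite unfold_in /PB3 gmulf1.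
by move=> a b; rewrite !unfold_in /PB3 gmulfF /= => /eqP -> /eqP ->; rewrite divg1.
Qed.

Lemma PB3_conj a b : a \in PB3 -> a ^ b \in PB3.
Proof. by rewrite !unfold_in /PB3 gmulfJ /= => /eqP ->; rewrite conj1g. Qed.

Lemma PB3M a b : a \in PB3 -> b \in PB3 -> a * b \in PB3.
Proof. exact: (group_closedM PB3_group). Qed.
Lemma PB3V a : a \in PB3 -> a^-1 \in PB3.
Proof. exact: (group_closedV PB3_group). Qed.

Definition transversal (t : coset3) : B3 :=
  match t with
  | C1 => 1 | Ca => s1 | Cb => s2 | Cab => s1 * s2 | Cba => s2 * s1
  | Caba => s1 * s2 * s1
  end.

Lemma braid : s1 * s2 * s1 = s2 * s1 * s2.
Proof.
apply: divg1_eq.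
have := weq_relator (R := [:: braid_relator]) [::] [::] (mem_head braid_relator [::]).
move/wclsE; rewrite !wcls_weval cats0 /weval !big_cons big_nil /= -/s1 -/s2 => h.
by rewrite !invgM -!mulgA; move: h; rewrite mulg1.
Qed.

Lemma perm_transversal t : braid_perm (transversal t) = 1 -> t = C1.
Proof.
have d01 : ord3 0 != ord3 1 by rewrite -val_eqE /= !inordK.
have d02 : ord3 0 != ord3 2 by rewrite -val_eqE /= !inordK.
have d12 : ord3 1 != ord3 2 by rewrite -val_eqE /= !inordK.
pose p1 := tperm (ord3 0) (ord3 1); pose p2 := tperm (ord3 1) (ord3 2).
have p10 : p1 (ord3 0) = ord3 1 by rewrite tpermL.
have p12 : p1 (ord3 2) = ord3 2 by rewrite tpermD // eq_sym.
have p20 : p2 (ord3 0) = ord3 0 by rewrite tpermD // eq_sym.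
have p21 : p2 (ord3 1) = ord3 2 by rewrite tpermL.
case: t; rewrite /= ?gmulfM /= ?gmulfM /= ?braid_perm_s1 ?braid_perm_s2 -/p1 -/p2 //
  => /permP h.
- by move: (h (ord3 0)) d01; rewrite p10 perm1 => ->; rewrite eqxx.
- by move: (h (ord3 1)) d12; rewrite p21 perm1 => ->; rewrite eqxx.
- by move: (h (ord3 0)) d02; rewrite permM p10 p21 perm1 => ->; rewrite eqxx.
- by move: (h (ord3 0)) d01; rewrite permM p20 p10 perm1 => ->; rewrite eqxx.
- by move: (h (ord3 0)) d02; rewrite !permM p10 p21 p12 perm1 => ->; rewrite eqxx.
Qed.

(* Every b in B3 is (an element of <x12, x23, cc>) * (its representative).    *)
Lemma schreier_decomp (G : groupType) (u v : G) (H : {pred B3}) (b : B3) :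
  group_closed H -> x12 \in H -> x23 \in H -> cc \in H ->
  exists2 h, h \in H & b = h * transversal (schreier_act u v (1, C1) b).2.
Proof.
move=> gH hx hy hc.
have hM := group_closedM gH; have hV := group_closedV gH.
have h1 : 1 \in H by case: gH.
pose coc i t : B3 :=
  pair2 match t with
        | Ca => x12 | Cba => x12^-1 * (cc * x23^-1) | Caba => x23 | _ => 1
        end
        match t with
        | Cb => x23 | Cab => x23^-1 * (cc * x12^-1) | Caba => x12 | _ => 1
        end i.
have cH i t : coc i t \in H.
  by case: (I2E i) => ->; case: t; rewrite /coc /pair2 /=;
     do ?[exact: h1|exact: hx|exact: hy|exact: hc|apply: (hV)|apply: (hM)].
have E i t : transversal t * pgen _ i = coc i t * transversal (schreier_next i t).
  have br z : z * s1 * s2 * s1 = z * s2 * s1 * s2.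
    by rewrite -!mulgA (mulgA s1) braid !mulgA.
  have ex : x12 = s1 * s1 by [].
  have ey : x23 = s2 * s2 by [].
  have ec : cc = s1 * s2 * s1 * (s1 * s2 * s1) by [].
  have c1 : cc = x23 * s1 * x23 * s1 by rewrite ec ey {1}braid !mulgA (br s2).
  have c2 : cc = x12 * s2 * x12 * s2 by rewrite ec ex {2}braid !mulgA -(br s1).
  case: (I2E i) => ->; rewrite -/s1 -/s2; case: t;
    rewrite /coc /pair2 /= ?mulg1 ?mul1g //.
  - by rewrite c2 ex ey !gnorm.
  - by rewrite braid (br s2) ey !mulgA.
  - by rewrite c1 ex ey !gnorm.
  - by rewrite braid.
  - by rewrite -(br s1) ex !mulgA.
elim/pres_ind: b => [|b i [h hH IH]|b i [h hH IH]].
- by exists 1 => //; rewrite schreier_act1 mulg1.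
- move: IH; rewrite schreier_actM schreier_act_gen.
  case: (schreier_act _ _ _ b) => g t /= ->; exists (h * coc i t); first exact: hM.
  by rewrite -mulgA E mulgA.
move: IH; rewrite schreier_actM schreier_act_genV.
case: (schreier_act _ _ _ b) => g t /= ->.
exists (h * (coc i (schreier_next i t))^-1); first by apply: (hM) => //; apply: hV.
rewrite -!mulgA; congr (_ * _); apply: (@mulgI _ (coc i (schreier_next i t))).
by rewrite mulVKg mulgA; have := E i (schreier_next i t); rewrite schreier_nextK => <-;
   rewrite mulgK.
Qed.

Lemma x12_PB3 : x12 \in PB3.
Proof. by rewrite unfold_in /PB3 gmulfM /= braid_perm_s1 tperm2. Qed.
Lemma x23_PB3 : x23 \in PB3.
Proof. by rewrite unfold_in /PB3 gmulfM /= braid_perm_s2 tperm2. Qed.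
Lemma cc_PB3 : cc \in PB3.
Proof.
rewrite unfold_in /PB3 -[cc]/(s1 * s2 * s1 * (s1 * s2 * s1)).
rewrite !gmulfM /= braid_perm_s1 braid_perm_s2.
set p := tperm _ _; set q := tperm _ _.
have pp : p * p = 1 by rewrite /p tperm2.
have qq : q * q = 1 by rewrite /q tperm2.
by rewrite -!mulgA (mulgA p p) pp mul1g (mulgA q q) qq mul1g pp.
Qed.

Section SchreierMorphism.
Variables (G : groupType) (u v : G).

Lemma schreier_PB3 b : b \in PB3 ->
  schreier_act u v (1, C1) b = (schreier u v b, C1).
Proof.
move=> hb; have [h hh E] := schreier_decomp u v b PB3_group x12_PB3 x23_PB3 cc_PB3.
rewrite /schreier; case: schreier_act E => g t /= E; congr pair.
apply: perm_transversal; rewrite -(mulKg h (transversal t)) -E.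
by have := PB3M (PB3V hh) hb; rewrite unfold_in => /eqP.
Qed.

Lemma schreierM a b : a \in PB3 -> b \in PB3 ->
  schreier u v (a * b) = schreier u v a * schreier u v b.
Proof.
move=> ha hb; rewrite {1}/schreier schreier_actM (schreier_PB3 ha).
by rewrite -[X in (X, C1)]mulg1 schreier_act_fst.
Qed.

Lemma schreier_x12 : schreier u v x12 = u.
Proof.
rewrite /schreier /x12 -[s1 ^+ 2]/(s1 * s1) schreier_actM.
by rewrite !schreier_act_gen /= /schreier_coc /pair2 /= !mul1g.
Qed.

Lemma schreier_x23 : schreier u v x23 = v.
Proof.
rewrite /schreier /x23 -[s2 ^+ 2]/(s2 * s2) schreier_actM.
by rewrite !schreier_act_gen /= /schreier_coc /pair2 /= !mul1g.
Qed.

Lemma schreier_cc : schreier u v cc = 1.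
Proof.
rewrite /schreier -[cc]/(s1 * s2 * s1 * (s1 * s2 * s1)) !schreier_actM.
rewrite !schreier_act_gen /= /schreier_coc /pair2 /= ?mul1g.
by rewrite !gnorm.
Qed.
End SchreierMorphism.

Lemma PB3_gen (H : {pred B3}) : group_closed H ->
  x12 \in H -> x23 \in H -> cc \in H -> {subset PB3 <= H}.
Proof.
move=> gH hx hy hc b hb.
have [h hh ->] := schreier_decomp (1 : B3) 1 b gH hx hy hc.
by rewrite schreier_PB3 //= mulg1.
Qed.

(* schreier u v is the only homomorphism on PB3 with the prescribed values.   *)
Lemma schreier_unique (G : groupType) (u v : G) (phi : B3 -> G) :
  {in PB3 &, {morph phi : a b / a * b}} ->
  phi x12 = u -> phi x23 = v -> phi cc = 1 -> {in PB3, phi =1 schreier u v}.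
Proof.
move=> phiM hx hy hc b hb.
pose H : {pred B3} := fun a => (a \in PB3) && (phi a == schreier u v a).
have inH a : (a \in H) = (a \in PB3) && (phi a == schreier u v a) by [].
have P1 : 1 \in PB3 by case: PB3_group.
have phi1 : phi 1 = 1.
  by apply: (@mulgI _ (phi 1)); rewrite -phiM // !mulg1.
have sch1 : schreier u v 1 = 1 by rewrite /schreier schreier_act1.
have gH : group_closed H.
  split; first by rewrite inH P1 phi1 sch1 eqxx.
  move=> a a'; rewrite !inH => /andP[ha /eqP ea] /andP[ha' /eqP ea'].
  have haV := PB3V ha'; rewrite PB3M //= phiM // schreierM // ea; apply/eqP.
  congr (_ * _); apply: (@mulgI _ (phi a')).
  by rewrite -phiM // {1}ea' -schreierM // !mulgV phi1 sch1.
have: b \in H; last by rewrite inH; case/andP => _ /eqP.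
apply: PB3_gen hb => //; rewrite inH.
- by rewrite x12_PB3 hx schreier_x12 eqxx.
- by rewrite x23_PB3 hy schreier_x23 eqxx.
- by rewrite cc_PB3 hc schreier_cc eqxx.
Qed.

Lemma iota_PB3 f : iotaF f \in PB3.
Proof.
rewrite unfold_in /PB3; elim/pres_ind: f => [|f i|f i]; first by rewrite !gmulf1.
  rewrite !gmulfM /= => /eqP ->; rewrite mul1g.
  by case: (I2E i) => ->; [rewrite iota_x; exact: x12_PB3|rewrite iota_y; exact: x23_PB3].
rewrite !gmulfF /= => /eqP ->; rewrite div1g invg_eq1.
by case: (I2E i) => ->; [rewrite iota_x; exact: x12_PB3|rewrite iota_y; exact: x23_PB3].
Qed.

Lemma iotaK : cancel iotaF (schreier x_F2 y_F2).
Proof.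
have hM : monoid_morphism (schreier x_F2 y_F2 \o iotaF).
  split=> [|f g]; first by rewrite /= gmulf1 /schreier schreier_act1.
  by rewrite /= gmulfM schreierM //; exact: iota_PB3.
pose F : UMagmaMorphism.type F2 F2 := HB.pack (schreier x_F2 y_F2 \o iotaF)
  (isUMagmaMorphism.Build F2 F2 _ hM).
move=> f; rewrite -[LHS]/(F f) -[RHS]/(idfun f).
apply: morphism_ext => i; case: (I2E i) => -> /=.
  by rewrite iota_x schreier_x12.
by rewrite iota_y schreier_x23.
Qed.

Lemma iota_inj : injective iotaF. Proof. exact: can_inj iotaK. Qed.


Definition finite_index (G : groupType) (N : {pred G}) : Prop :=
  exists l : seq G, forall g : G, exists2 t, t \in l & t^-1 * g \in N.

Definition NFI : set (normalSub B3) :=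
  [set N | {subset N <= PB3} /\ finite_index N].

(* lcm of the orders of x12 N, x23 N, cc N in PB3 / N, a subgroup of B3 / N *)
Definition Nord (N : normalSub B3) : nat :=
  lcmn (lcmn (ordg (cls N x12)) (ordg (cls N x23))) (ordg (cls N cc)).

Section NF2.
Variable N : normalSub B3.

Definition NF2_pred : {pred F2} := fun f => iotaF f \in N.

Lemma NF2_group : group_closed NF2_pred.
Proof.
split; first by rewrite unfold_in /NF2_pred gmulf1 nsub1.
move=> a b; rewrite !unfold_in /NF2_pred gmulfF => ha hb.
by apply: nsubM ha (nsubV hb).
Qed.

Lemma NF2_conj f g : f \in NF2_pred -> f ^ g \in NF2_pred.
Proof. by rewrite !unfold_in /NF2_pred gmulfJ; apply: normal_conj. Qed.

Definition NF2 : normalSub F2 := NormalSub NF2_group NF2_conj.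
End NF2.

Section GT.
Variable N : normalSub B3.

(* [m, f], the class of m in Z / Nord N Z being the set m + Nord N Z *)
Definition shadow (m : int) (f : F2) : set int * quo (NF2 N) :=
  ([set k | (k = m %[mod Nord N])%Z], cls (NF2 N) f).

Definition hexagon (m : int) (f : F2) : Prop :=
  let F := iotaF f in
  let k := (2 * m + 1)%R in
  cls N (expgz s1 k * F^-1 * expgz s2 k * F)
    = cls N (F^-1 * s1 * s2 * expgz x12 (- m)%R * expgz cc m) /\
  cls N (F^-1 * expgz s2 k * F * expgz s1 k)
    = cls N (s2 * s1 * expgz x23 (- m)%R * expgz cc m * F).

Definition T_surjective (m : int) (f : F2) : Prop :=
  let F := iotaF f in
  let k := (2 * m + 1)%R in
  exists T : UMagmaMorphism.type B3 (quo N),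
    [/\ T s1 = cls N (expgz s1 k),
        T s2 = cls N (F^-1 * expgz s2 k * F)
      & forall z, exists b, T b = z].

Definition GT : set (set int * quo (NF2 N)) :=
  [set p | exists m f,
     [/\ p = shadow m f,
         hexagon m f,
         coprimez (2 * m + 1)%R (Nord N),
         commutator_subgroup (cls (NF2 N) f)
       & T_surjective m f]].
End GT.

Arguments shadow : clear implicits.
Arguments GT : clear implicits.

Definition dihedral_relators (n : nat) : seq (word 2) :=
  [:: nseq n (i0, false);
      [:: (i1, false); (i1, false)];
      [:: (i1, false); (i0, false); (i1, true); (i0, false)]].

Definition Dih (n : nat) := pres (dihedral_relators n).
HB.instance Definition _ n := Group.on (Dih n).

Definition rr n : Dih n := pgen _ i0.
Definition ss n : Dih n := pgen _ i1.

(* The homomorphism PB3 -> D_n^3 of psiM, psi_x12, psi_x23, psi_cc, which is   *)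
(* uniquely determined by these equations (schreier_unique); the values of     *)
(* psi n outside of PB3 are irrelevant.                                        *)
Definition psi n : B3 -> Dih n * Dih n * Dih n :=
  schreier (rr n, ss n, ss n) (rr n * ss n, rr n, rr n * ss n).

Lemma psiM n : {in PB3 &, {morph @psi n : a b / a * b}}.
Proof. exact: schreierM. Qed.
Lemma psi_x12 n : psi n x12 = (rr n, ss n, ss n).
Proof. exact: schreier_x12. Qed.
Lemma psi_x23 n : psi n x23 = (rr n * ss n, rr n, rr n * ss n).
Proof. exact: schreier_x23. Qed.
Lemma psi_cc n : psi n cc = (1, 1, 1).
Proof. exact: schreier_cc. Qed.

Definition K_pred n : {pred B3} := fun b => (b \in PB3) && (psi n b == 1).

Section Dihedral.
Variable n : nat.
Notation r := (rr n).
Notation s := (ss n).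

Lemma weval_rel1 (G : groupType) (a : 'I_2 -> G) :
  weval a (nseq n (i0, false)) = a i0 ^+ n.
Proof. by rewrite /weval big_nseq -Monoid.iteropE. Qed.

Lemma rr_n : r ^+ n = 1.
Proof.
have := weq_relator (R := dihedral_relators n) [::] [::] (mem_head _ _).
by move/wclsE; rewrite !wcls_weval cats0 /= weval_rel1 /weval big_nil.
Qed.

Lemma ss2 : s * s = 1.
Proof.
have h : [:: (i1, false); (i1, false)] \in dihedral_relators n by rewrite !inE eqxx orbT.
have := weq_relator [::] [::] h.
by move/wclsE; rewrite !wcls_weval cats0 /weval !big_cons big_nil mulg1.
Qed.

Lemma ssV : s^-1 = s. Proof. exact: mulg1_eq ss2. Qed.

Lemma srsr : s * r * s * r = 1.
Proof.
have h : [:: (i1, false); (i0, false); (i1, true); (i0, false)] \in dihedral_relators n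
  by rewrite !inE eqxx !orbT.
have := weq_relator [::] [::] h.
move/wclsE; rewrite !wcls_weval cats0 /weval !big_cons big_nil mulg1 /= -/s -/r.
by rewrite ssV !mulgA.
Qed.

Lemma srs : s * r * s = r^-1.
Proof. by apply/esym/mulg1_eq/(@mulgI _ (s * r * s)); rewrite mulgA srsr mul1g mulg1. Qed.

Lemma D_lift (G : groupType) (a b : G) : a ^+ n = 1 -> b * b = 1 ->
  b * a * b * a = 1 -> forall w, w \in dihedral_relators n -> weval (pair2 a b) w = 1.
Proof.
move=> h1 h2 h3 w; rewrite !inE => /or3P[] /eqP ->.
- by rewrite weval_rel1.
- by rewrite /weval !big_cons big_nil mulg1.
rewrite /weval !big_cons big_nil mulg1 /= /pair2 /=.
by rewrite (mulg1_eq h2) !mulgA.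
Qed.

Lemma srVs : s * (r^-1 * s) = r.
Proof. by apply: invg_inj; rewrite !invgM invgK ssV srs. Qed.

Lemma rVs : r^-1 * s = s * r.
Proof. by apply: (@mulgI _ s); rewrite srVs mulgA ss2 mul1g. Qed.

Lemma srV : s * r^-1 = r * s.
Proof. by rewrite -srs !mulgA ss2 mul1g. Qed.

Definition Dtwist : Dih n -> Dih n := plift (pair2 r (r^-1 * s)).

Lemma Dtwist_rel w : w \in dihedral_relators n ->
  weval (pair2 r (r^-1 * s)) w = 1.
Proof.
apply: D_lift; first exact: rr_n.
  by rewrite -!mulgA srVs mulVg.
by rewrite -!mulgA mulVKg (mulgA s s) ss2 mul1g mulVg.
Qed.

HB.instance Definition _ := isUMagmaMorphism.Build (Dih n) (Dih n) Dtwist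
  (lift_morphism Dtwist_rel).

Lemma Dtwist_r : Dtwist r = r. Proof. exact: (lift_gen Dtwist_rel). Qed.
Lemma Dtwist_s : Dtwist s = r^-1 * s. Proof. exact: (lift_gen Dtwist_rel). Qed.

Lemma s_rX i : s * r ^+ i = r ^- i * s.
Proof.
have e : s * r = r^-1 * s by rewrite -srs -mulgA ss2 mulg1.
elim: i => [|i IH]; first by rewrite invg1 mulg1 mul1g.
by rewrite expgSr mulgA IH -mulgA e mulgA -invgM -expgS -expgSr.
Qed.

Lemma D_normal_form (g : Dih n) : (0 < n)%N ->
  exists i j, [/\ (i < n)%N, (j < 2)%N & g = r ^+ i * s ^+ j].
Proof.
move=> n0.
have rmod i : r ^+ (i %% n) = r ^+ i.
  by rewrite [in RHS](divn_eq i n) expgnDr mulnC expgnA rr_n expg1n mul1g.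
have rV : r^-1 = r ^+ n.-1.
  by apply: mulg1_eq; rewrite -expgS prednK // rr_n.
have rVX i : r ^- i = r ^+ (n.-1 * i) by rewrite -expVgn rV expgnA.
have smod j : s ^+ (j %% 2) = s ^+ j.
  by rewrite [in RHS](divn_eq j 2) expgnDr mulnC expgnA (ss2 : s ^+ 2 = 1) expg1n mul1g.
suff [i [j ->]] : exists i j, g = r ^+ i * s ^+ j.
  by exists (i %% n)%N, (j %% 2)%N; rewrite !ltn_mod n0 rmod smod.
elim/pres_ind: g => [|g i [a [b ->]]|g i [a [b ->]]].
- by exists 0%N, 0%N; rewrite mulg1.
- case: (I2E i) => ->; last by exists a, b.+1; rewrite expgSr mulgA.
  rewrite -(smod b); have: (b %% 2 < 2)%N by rewrite ltn_mod.
  case: (b %% 2)%N => [|[|//]] _; first by exists a.+1, 0%N; rewrite !mulg1 expgSr.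
  exists (a + n.-1)%N, 1%N; rewrite expg1 -mulgA (s_rX 1) expgnDr -rV.
  by rewrite expg1 mulgA.
case: (I2E i) => ->; last by exists a, b.+1; rewrite -/s ssV expgSr mulgA.
rewrite -/r -(smod b); have: (b %% 2 < 2)%N by rewrite ltn_mod.
case: (b %% 2)%N => [|[|//]] _.
  by exists (a + n.-1)%N, 0%N; rewrite !mulg1 expgnDr -rV.
exists a.+1, 1%N; rewrite expg1 -mulgA rV s_rX rVX.
have -> : r ^+ (n.-1 * n.-1) = r by rewrite -rVX -rV invgK.
by rewrite mulgA -expgSr.
Qed.
End Dihedral.

Lemma K_group n : group_closed (K_pred n).
Proof.
have hE a : (a \in K_pred n) = (a \in PB3) && (psi n a == 1) by [].
have P1 : 1 \in PB3 by case: PB3_group.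
have psi1 : psi n 1 = 1 by rewrite /psi /schreier schreier_act1.
split; first by rewrite hE P1 psi1 eqxx.
move=> a b; rewrite !hE => /andP[ha /eqP ea] /andP[hb /eqP eb].
have hbV := PB3V hb; rewrite PB3M // psiM // ea mul1g /=.
apply/eqP; apply: (@mulgI _ (psi n b)).
by rewrite -psiM // mulgV psi1 eb mulg1.
Qed.

Lemma schreier_conj (G H : groupType) (u v : G) (u' v' : H) (t : B3)
    (A : G -> H) : monoid_morphism A ->
  schreier u' v' (x12 ^ t) = A u -> schreier u' v' (x23 ^ t) = A v ->
  schreier u' v' (cc ^ t) = 1 ->
  {in PB3, forall b, schreier u' v' (b ^ t) = A (schreier u v b)}.
Proof.
move=> [A1 AM] hx hy hc b hb.
have AV a : A a^-1 = (A a)^-1 by apply/esym/mulg1_eq; rewrite -AM mulgV.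
have P1 : 1 \in PB3 by case: PB3_group.
pose E : {pred B3} := fun a =>
  (a \in PB3) && (schreier u' v' (a ^ t) == A (schreier u v a)).
have inE' a : (a \in E) =
  (a \in PB3) && (schreier u' v' (a ^ t) == A (schreier u v a)) by [].
have gE : group_closed E.
  have s1' (G' : groupType) (w z : G') : schreier w z 1 = 1 by rewrite /schreier schreier_act1.
  have sV (G' : groupType) (w z : G') a : a \in PB3 -> schreier w z a^-1 = (schreier w z a)^-1.
    move=> ha; apply/esym/mulg1_eq; rewrite -schreierM ?mulgV ?s1' //.
    exact: PB3V.
  split; first by rewrite inE' P1 conj1g !s1' A1 eqxx.
  move=> a a'; rewrite !inE' => /andP[ha /eqP ea] /andP[ha' /eqP ea'].
  have haV := PB3V ha'; have hc1 := PB3_conj t ha; have hc2 := PB3_conj t ha'.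
  rewrite PB3M //= conjMg conjVg (schreierM _ _ hc1 (PB3V hc2)) (sV _ _ _ _ hc2).
  rewrite (schreierM _ _ ha haV) (sV _ _ _ _ ha') ea ea'.
  by rewrite AM AV.
have: b \in E; last by rewrite inE'; case/andP => _ /eqP.
apply: PB3_gen hb => //; rewrite inE'.
- by rewrite x12_PB3 hx schreier_x12 eqxx.
- by rewrite x23_PB3 hy schreier_x23 eqxx.
- by rewrite cc_PB3 hc schreier_cc A1 eqxx.
Qed.

Section ConjGen.
Variables (G : groupType) (u v : G).

Lemma conj_x12_s1 : schreier u v (x12 ^ s1) = u.
Proof.
rewrite /schreier conjgE -[x12]/(s1 * s1) !schreier_actM !schreier_act_genV
  !schreier_act_gen /= /schreier_coc /pair2 /=.
by rewrite !gnorm.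
Qed.
Lemma conj_x23_s1 : schreier u v (x23 ^ s1) = u^-1 * v^-1.
Proof.
rewrite /schreier conjgE -[x23]/(s2 * s2) !schreier_actM !schreier_act_genV
  !schreier_act_gen /= /schreier_coc /pair2 /=.
by rewrite !gnorm.
Qed.
Lemma conj_cc_s1 : schreier u v (cc ^ s1) = 1.
Proof.
rewrite /schreier conjgE -[cc]/(s1 * s2 * s1 * (s1 * s2 * s1)) !schreier_actM
  !schreier_act_genV !schreier_act_gen /= /schreier_coc /pair2 /=.
by rewrite !gnorm.
Qed.
Lemma conj_x12_s2 : schreier u v (x12 ^ s2) = v^-1 * u^-1.
Proof.
rewrite /schreier conjgE -[x12]/(s1 * s1) !schreier_actM !schreier_act_genV
  !schreier_act_gen /= /schreier_coc /pair2 /=.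
by rewrite !gnorm.
Qed.
Lemma conj_x23_s2 : schreier u v (x23 ^ s2) = v.
Proof.
rewrite /schreier conjgE -[x23]/(s2 * s2) !schreier_actM !schreier_act_genV
  !schreier_act_gen /= /schreier_coc /pair2 /=.
by rewrite !gnorm.
Qed.
Lemma conj_cc_s2 : schreier u v (cc ^ s2) = 1.
Proof.
rewrite /schreier conjgE -[cc]/(s1 * s2 * s1 * (s1 * s2 * s1)) !schreier_actM
  !schreier_act_genV !schreier_act_gen /= /schreier_coc /pair2 /=.
by rewrite !gnorm.
Qed.
End ConjGen.

Lemma psi_conj_s1 n : {in PB3, forall b,
  psi n (b ^ s1) = let: (a1, a2, a3) := psi n b in (Dtwist a1, a3, a2 ^ ss n)}.
Proof.
set r := rr n; set s := ss n.
pose A (p : Dih n * Dih n * Dih n) := let: (a1, a2, a3) := p in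
  (Dtwist a1, a3, a2 ^ s) : Dih n * Dih n * Dih n.
have ssE : s^-1 = s by exact: ssV.
apply: (@schreier_conj _ _ _ _ _ _ _ A).
- split; first by rewrite /A /= gmulf1 conj1g.
  by case=> [[a1 a2] a3] [[b1 b2] b3]; rewrite /A /= gmulfM conjMg.
- by rewrite conj_x12_s1 /A Dtwist_r conjgE mulKg.
- rewrite conj_x23_s1 /A gmulfM /= Dtwist_r Dtwist_s -/r -/s mulVKg.
  change ((r^-1 * (r * s)^-1, s^-1 * r^-1, s^-1 * (r * s)^-1)
          = (s, r * s, r ^ s)).
  rewrite invgM conjgE ssE mulgA rVs mulgK srV.
  by [].
- exact: conj_cc_s1.
Qed.

Lemma psi_conj_s2 n : {in PB3, forall b,
  psi n (b ^ s2) =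
  let: (a1, a2, a3) := psi n b in (a3 ^ (rr n * ss n), Dtwist a2, a1)}.
Proof.
set r := rr n; set s := ss n.
pose A (p : Dih n * Dih n * Dih n) := let: (a1, a2, a3) := p in
  (a3 ^ (r * s), Dtwist a2, a1) : Dih n * Dih n * Dih n.
have ssE : s^-1 = s by exact: ssV.
apply: (@schreier_conj _ _ _ _ _ _ _ A).
- split; first by rewrite /A /= gmulf1 conj1g.
  by case=> [[a1 a2] a3] [[b1 b2] b3]; rewrite /A /= gmulfM conjMg.
- rewrite conj_x12_s2 /A Dtwist_s -/r -/s.
  change (((r * s)^-1 * r^-1, r^-1 * s^-1, (r * s)^-1 * s^-1)
          = (s ^ (r * s), r^-1 * s, r)).
  rewrite invgM conjgE invgM ssE -(mulgA s r^-1 s) srVs.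
  by rewrite -(mulgA s _ (s * _)) (mulgA s r s) srs mulgA.
- by rewrite conj_x23_s2 /A Dtwist_r conjgE mulKg.
- exact: conj_cc_s2.
Qed.

Lemma K_conj n a b : a \in K_pred n -> a ^ b \in K_pred n.
Proof.
have hE c : (c \in K_pred n) = (c \in PB3) && (psi n c == 1) by [].
have K1 c : c \in K_pred n -> c ^ s1 \in K_pred n.
  rewrite !hE => /andP[hc /eqP ec]; rewrite PB3_conj // psi_conj_s1 //= ec.
  by rewrite /= gmulf1 conj1g.
have K2 c : c \in K_pred n -> c ^ s2 \in K_pred n.
  rewrite !hE => /andP[hc /eqP ec]; rewrite PB3_conj // psi_conj_s2 //= ec.
  by rewrite /= gmulf1 conj1g.
have KP c d : d \in PB3 -> c \in K_pred n -> c ^ d \in K_pred n.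
  move=> hd; rewrite !hE => /andP[hc /eqP ec]; rewrite PB3_conj //=.
  have e : psi n d * psi n (c ^ d) = psi n d.
    by rewrite -psiM ?PB3_conj // conjgE mulVKg psiM // ec mul1g.
  by apply/eqP/(@mulgI _ (psi n d)); rewrite e mulg1.
have conjV (s c : B3) : c ^ s^-1 = (c ^ s) ^ (s ^+ 2)^-1.
  by rewrite -conjgM -[s ^+ 2]/(s * s) invgM mulgA mulgV mul1g.
elim/pres_ind: b a => [|b i IH|b i IH] a ha; first by rewrite conjg1.
  by rewrite conjgM; case: (I2E i) => ->; [apply: K1|apply: K2]; apply: IH.
rewrite conjgM; have {}ha := IH a ha.
case: (I2E i) => ->; rewrite -/s1 -/s2 conjV; apply: KP.
- exact/PB3V/x12_PB3.
- exact: K1.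
- exact/PB3V/x23_PB3.
- exact: K2.
Qed.

(* The kernel of psi n on PB3; it belongs to NFI, see K_NFI. *)
Definition K (n : nat) : normalSub B3 := NormalSub (@K_group n) (@K_conj n).

Lemma finite_index_fun (G : groupType) (T : eqType) (N : normalSub G)
    (f : G -> T) (l : seq T) :
  (forall g, f g \in l) -> (forall g h, f g = f h -> g^-1 * h \in N) ->
  finite_index N.
Proof.
move=> fl fN.
pose pre t : G := match pselect (exists g, f g = t) with
                  | left e => sval (cid e) | right _ => 1 end.
exists (map pre l) => g; exists (pre (f g)); first exact: map_f.
apply: fN; rewrite /pre; case: pselect => [e|[]]; last by exists g.
by case: (cid e).
Qed.

Lemma K_NFI n : (0 < n)%N -> NFI (K n).
Proof.
move=> n0; split=> [b /andP[] //|].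
pose dl : seq (Dih n) :=
  [seq rr n ^+ i * ss n ^+ j | i <- iota 0 n, j <- iota 0 2].
pose act b := (schreier_act (rr n, ss n, ss n) (rr n * ss n, rr n, rr n * ss n)
                 (1, C1) b).1.
pose f b : Dih n * Dih n * Dih n * 'S_3 := (act b, braid_perm b).
pose l := [seq (p, z) | p <- [seq (q, d) | q <- [seq (a, b) | a <- dl, b <- dl],
                                           d <- dl], z <- enum 'S_3].
have dlP d : d \in dl.
  have [i [j [hi hj ->]]] := D_normal_form d n0.
  by apply: allpairs_f; rewrite mem_iota.
apply: (@finite_index_fun _ _ _ f l) => [g|g h [eact eperm]].
  rewrite /f; case: (act g) => [[a b] c].
  apply: allpairs_f; last by rewrite mem_enum.
  apply: allpairs_f; last exact: dlP.
  by apply: allpairs_f; exact: dlP.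
have hc : h * g^-1 \in PB3 by rewrite unfold_in /PB3 gmulfF /= eperm divgg.
have hg : h = h * g^-1 * g by rewrite mulgVK.
have : h * g^-1 \in K_pred n.
  rewrite -[_ \in _]/((h * g^-1 \in PB3) && (psi n (h * g^-1) == 1)) hc /=.
  have e : act h = psi n (h * g^-1) * act g.
    by rewrite {1}hg /act schreier_actM schreier_PB3 // -[X in (X, C1)]mulg1
       schreier_act_fst.
  by apply/eqP; apply: (@mulIg _ (act g)); rewrite -e eact mul1g.
move/(K_conj g); rewrite conjgE mulgVK; exact.
Qed.

(* Main.v *)
(* Modulo K := K^(n) everything happens in D_n^3.  The elements of F_2 whose
   three components are rotations have image <r^2>^3; on it theta acts by
   (a, b, c) |-> (b, a, -c) and tau permutes the coordinates cyclically.  Modulo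
   K, theta and tau are conjugation by the inverses of s1 s2 s1 and s1 s2, so the
   hexagons become the cocycle conditions theta(f) f = 1 and
   u tau^2(u) tau(u) = 1 for u = f x^m.
   As <r^2>^3 is an induced Z/3-module and tau permutes the nontrivial elements of
   the quotient (Z/2)^2 without fixed points, every tau-cocycle is a coboundary.
   This applies to u, and also to xy: modulo K the two cases of the statement
   have the same content.  The divisibility of n by 3 only serves to exclude
   m = 1 mod 3.
   For theta, f is a product of commutators, hence consists of rotations; the
   third coordinate of f is in <r^4>, or becomes so after absorbing
   [x, y] = theta(xy)^-1 xy. *)
From HB Require Import structures.
Require Import Defs.
From mathcomp Require Import all_boot all_order all_algebra.
From mathcomp Require Import perm boolp classical_sets.
From mathcomp Require Import zify.

Set Implicit Arguments.
Unset Strict Implicit.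

Local Open Scope group_scope.

(** * Integer powers in a group *)

Lemma expgzS (G : groupType) (x : G) (m : int) :
  expgz x (m + 1)%R = expgz x m * x.
Proof.
(* [Negz k] is -(k + 1): the exponent -1 steps to 0, across the two constructors, and is treated
   apart. *)
case: m => [k|[|k]]; first by rewrite -PoszD addn1 /= expgSr.
  by rewrite /= expg1 mulVg.
have -> : (Negz k.+1 + 1)%R = Negz k by lia.
by rewrite /= [x ^+ k.+2]expgS invgM mulgVK.
Qed.

Lemma expgzD (G : groupType) (x : G) (m p : int) :
  expgz x (m + p)%R = expgz x m * expgz x p.
Proof.
elim/int_ind: p => [|k IH|k IH]; first by rewrite GRing.addr0 mulg1.
  have -> : (m + k.+1%:Z = m + k%:Z + 1)%R by lia.
  have -> : (k.+1%:Z = k%:Z + 1)%R by lia.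
  by rewrite !expgzS IH mulgA.
apply: (@mulIg _ x); rewrite -mulgA -!expgzS.
have -> : (m - k.+1%:Z + 1 = m - k%:Z)%R by lia.
by have -> : (- k.+1%:Z + 1 = - k%:Z)%R by lia.
Qed.

Lemma expgz0 (G : groupType) (x : G) : expgz x 0 = 1.
Proof. by []. Qed.

Lemma expgz1 (G : groupType) (x : G) : expgz x 1 = x.
Proof. exact: expg1. Qed.

Lemma expg1z (G : groupType) (m : int) : expgz (1 : G) m = 1.
Proof. by case: m => k; rewrite /= expg1n ?invg1. Qed.

Lemma expgzN (G : groupType) (x : G) (m : int) :
  expgz x (- m)%R = (expgz x m)^-1.
Proof. by apply/esym/mulg1_eq; rewrite -expgzD GRing.subrr. Qed.

Lemma expgz_morph (G H : groupType) (f : UMagmaMorphism.type G H) (x : G)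
  (m : int) : f (expgz x m) = expgz (f x) m.
Proof. by case: m => k /=; rewrite ?gmulfV gmulfXn. Qed.

Lemma expgz_natM (G : groupType) (x : G) (k : nat) (m : int) :
  expgz x (k%:Z * m)%R = expgz (x ^+ k) m.
Proof.
elim/int_ind: m => [|m IH|m IH]; first by rewrite GRing.mulr0.
  have -> : (k%:Z * m.+1%:Z = k%:Z * m%:Z + k%:Z)%R by lia.
  have -> : (m.+1%:Z = m%:Z + 1)%R by lia.
  by rewrite !expgzD IH.
have -> : (k%:Z * - m.+1%:Z = k%:Z * - m%:Z + - k%:Z)%R by lia.
have -> : (- m.+1%:Z = - m%:Z + -1)%R by lia.
by rewrite !expgzD IH; congr (_ * _); rewrite !expgzN.
Qed.

(** Passes from one relation between the images of s1^2 and s2^2 to all their m-th powers, negative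
    ones included. *)
Lemma expgz_intertwine (G : groupType) (x y u : G) (m : int) :
  x * u = u * y -> expgz x m * u = u * expgz y m.
Proof.
move=> h; elim/int_ind: m => [|k IH|k IH]; first by rewrite mulg1 mul1g.
  have -> : (k.+1%:Z = k%:Z + 1)%R by lia.
  by rewrite !expgzS -mulgA h !mulgA IH.
apply: (@mulIg _ y); rewrite -!mulgA -expgzS -h mulgA -expgzS.
by have -> : (- k.+1%:Z + 1 = - k%:Z)%R by lia.
Qed.

(** For x of infinite order the default value 0 turns the equation into x^0 = 1. *)
Lemma ordg_expg (G : groupType) (x : G) : x ^+ ordg x = 1.
Proof.
rewrite /ordg; case: pselect => // ex.
by case: ex_minnP => k /andP[_ /eqP].
Qed.

(** * Normal forms in the dihedral group *)

(** The exponent is an integer that is never reduced modulo n, so its parity can be tracked even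
    when n is odd. *)
Definition dih n (a : int) (e : bool) : Dih n :=
  expgz (rr n) a * (if e then ss n else 1).

Lemma s_expgz n a : ss n * expgz (rr n) a = expgz (rr n) (- a)%R * ss n.
Proof.
have e : ss n * rr n = (rr n)^-1 * ss n by rewrite rVs.
elim/int_ind: a => [|k IH|k IH]; first by rewrite mulg1 mul1g.
  have -> : (- k.+1%:Z = - k%:Z + -1)%R by lia.
  have -> : (k.+1%:Z = k%:Z + 1)%R by lia.
  by rewrite !expgzD expgz1 mulgA IH -!mulgA e.
apply: (@mulIg _ (rr n)); rewrite -!mulgA e -expgzS.
have -> : (- k.+1%:Z + 1 = - k%:Z)%R by lia.
have -> : (- - k.+1%:Z = - - k%:Z + 1)%R by lia.
by rewrite IH expgzS mulgA mulgK.
Qed.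

Lemma dihM n a e a' e' :
  dih n a e * dih n a' e' = dih n (a + (if e then - a' else a'))%R (e (+) e').
Proof.
rewrite /dih; case: e => /=; rewrite !expgzD.
  rewrite -!mulgA; congr (_ * _); rewrite mulgA s_expgz -!mulgA; congr (_ * _).
  by case: e'; rewrite ?mulg1 ?ss2.
by case: e' => /=; rewrite ?mulg1 ?mulgA.
Qed.

Lemma dih1 n : dih n 0 false = 1.
Proof. exact: mulg1. Qed.

Lemma dihV n a e : (dih n a e)^-1 = dih n (if e then a else - a)%R e.
Proof.
apply: mulg1_eq; rewrite dihM addbb -dih1; congr dih.
by case: e; lia.
Qed.

Lemma dih_comm n a e a' e' :
  [~ dih n a e, dih n a' e'] =
  dih n (2 * (if e then if e' then a - a' else a' else if e' then - a else 0))%R false.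
Proof.
rewrite /commg /conjg !dihV !dihM; congr dih; case: e; case: e' => //=; lia.
Qed.

(** * The image of F_2 in D_n^3 *)

Definition phi n (u : F2) : Dih n * Dih n * Dih n := psi n (iotaF u).

Lemma phi_is_morphism n : monoid_morphism (phi n).
Proof.
split=> [|u v]; first by rewrite /phi gmulf1 /psi /schreier schreier_act1.
by rewrite /phi gmulfM psiM //; exact: iota_PB3.
Qed.
HB.instance Definition _ n :=
  isUMagmaMorphism.Build F2 (Dih n * Dih n * Dih n)%type (phi n) (phi_is_morphism n).

Lemma phi_x n : phi n x_F2 = (dih n 1 false, dih n 0 true, dih n 0 true).
Proof. by rewrite /phi iota_x psi_x12 /dih expgz1 expgz0 !mul1g mulg1. Qed.

Lemma phi_y n : phi n y_F2 = (dih n 1 true, dih n 1 false, dih n 1 true).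
Proof. by rewrite /phi iota_y psi_x23 /dih expgz1 mulg1. Qed.

Lemma mul3E (A : groupType) (a b c a' b' c' : A) :
  (a, b, c) * (a', b', c') = (a * a', b * b', c * c').
Proof. by []. Qed.

Lemma inv3E (A : groupType) (a b c : A) : (a, b, c)^-1 = (a^-1, b^-1, c^-1).
Proof. by []. Qed.

(** Here d and e are the parities of the exponent sums of x and y in u; they determine all six
    parities of the normal form. For odd n this concerns a suitable choice of the exponents a, b,
    c. *)
Lemma phi_shape n u : exists a b c d e,
  [/\ phi n u = (dih n a e, dih n b d, dih n c (d (+) e)),
      odd `|a|%N = d (+) e, odd `|b|%N = e & odd `|c|%N = e].
Proof.
pose shape (p : Dih n * Dih n * Dih n) := exists a b c d e,
  [/\ p = (dih n a e, dih n b d, dih n c (d (+) e)),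
      odd `|a|%N = d (+) e, odd `|b|%N = e & odd `|c|%N = e].
have shapeX p (t : int) : odd `|t|%N -> shape p ->
    shape (p * (dih n t false, dih n 0 true, dih n 0 true)).
  move=> ht [a] [b] [c] [d] [e] [-> ha hb hc]; rewrite mul3E !dihM.
  exists (a + (if e then - t else t))%R, b, c, (~~ d), e.
  split=> //; last by case: (d) ha; case: (e) => /=; lia.
  by case: (d); case: (e); congr (_, _, _); congr dih => /=; lia.
have shapeY p (t : int) : odd `|t|%N -> shape p ->
    shape (p * (dih n 1 true, dih n t false, dih n 1 true)).
  move=> ht [a] [b] [c] [d] [e] [-> ha hb hc]; rewrite mul3E !dihM.
  exists (a + (if e then -1 else 1))%R, (b + (if d then - t else t))%R,
    (c + (if d (+) e then -1 else 1))%R, d, (~~ e).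
  split; last by case: (d) hc; case: (e) => /=; lia.
  - by case: (d); case: (e); congr (_, _, _); congr dih => /=; lia.
  - by case: (d) ha; case: (e) => /=; lia.
  - by case: (d) hb; case: (e) => /=; lia.
rewrite -/(shape _); elim/pres_ind: u => [|u i IH|u i IH].
- exists 0%R, 0%R, 0%R, false, false; split=> //.
  by rewrite gmulf1 /= !dih1.
- rewrite gmulfM /=; case: (I2E i) => ->.
    by rewrite -/x_F2 phi_x; apply: shapeX.
  by rewrite -/y_F2 phi_y; apply: shapeY.
rewrite gmulfF /=; case: (I2E i) => ->.
  by rewrite -/x_F2 phi_x inv3E !dihV; apply: shapeX.
by rewrite -/y_F2 phi_y inv3E !dihV; apply: shapeY.
Qed.

Lemma NF2_clsE n u v :
  cls (NF2 (K n)) u = cls (NF2 (K n)) v <-> phi n u = phi n v.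
Proof.
split=> [/clsE|e]; last first.
  apply/clsE; change (iotaF (u^-1 * v) \in K_pred n).
  rewrite unfold_in /K_pred iota_PB3 -/(phi n _).
  by rewrite gmulfM gmulfV /= e mulVg eqxx.
rewrite -[_ \in _]/((iotaF (u^-1 * v) \in PB3) && (phi n (u^-1 * v) == 1)).
case/andP=> _ /eqP; rewrite gmulfM gmulfV /= => e.
by apply: (@mulgI _ (phi n u)^-1); rewrite e mulVg.
Qed.

(** Bridge between B3/K, where conjugation by s1 and s2 is available, and D_n^3, where explicit
    computation takes place. *)
Lemma K_clsE n u v :
  cls (K n) (iotaF u) = cls (K n) (iotaF v) <-> phi n u = phi n v.
Proof.
rewrite -NF2_clsE; split=> /clsE h; apply/clsE.
  by rewrite unfold_in /= /NF2_pred gmulfM gmulfV.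
by move: h; rewrite -[_ \in NF2 _]/(iotaF _ \in K n) gmulfM gmulfV.
Qed.

Lemma phi_eq1 n u : phi n u = 1 <-> cls (K n) (iotaF u) = 1.
Proof.
have e1 : phi n 1 = 1 by exact: gmulf1.
have e2 : cls (K n) (iotaF 1) = 1 by rewrite !gmulf1.
by rewrite -e1 -e2; apply: iff_sym; apply: K_clsE.
Qed.

(** * theta and tau as conjugations modulo K *)

Lemma cls_cc n : cls (K n) cc = 1.
Proof.
suff /esym : cls (K n) 1 = cls (K n) cc by [].
apply/clsE; rewrite invg1 mul1g.
by rewrite -[_ \in _]/((_ \in PB3) && (psi n cc == 1)) cc_PB3 psi_cc eqxx.
Qed.

Lemma s12_3 : (s1 * s2) ^+ 3 = cc.
Proof.
rewrite !expgS -[cc]/(s1 * s2 * s1 * (s1 * s2 * s1)) {2}braid.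
by rewrite mulg1 !mulgA.
Qed.

(* Only modulo K: in B3, tau(y) differs from the conjugate of y by the central cc. *)
Lemma iota_conj_cls n (b : B3) (g : UMagmaMorphism.type F2 F2) :
  (forall i, cls (K n) (iotaF (g (pgen _ i))) = cls (K n) (iotaF (pgen _ i) ^ b)) ->
  forall u, cls (K n) (iotaF (g u)) = cls (K n) (iotaF u ^ b).
Proof.
move=> h u.
pose F0 (v : F2) : quo (K n) := cls (K n) (iotaF v ^ b).
have hM : monoid_morphism F0.
  split=> [|v w]; first by rewrite /F0 gmulf1 conj1g gmulf1.
  by rewrite /F0 [iotaF _]gmulfM /= conjMg gmulfM.
pose F : UMagmaMorphism.type F2 (quo (K n)) :=
  HB.pack F0 (isUMagmaMorphism.Build F2 (quo (K n)) F0 hM).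
exact: (@morphism_ext _ _ _ (cls (K n) \o iotaF \o g) F h u).
Qed.

Lemma s1_conj_Delta : s1 ^ (s1 * s2 * s1)^-1 = s2.
Proof.
apply: (@mulIg _ (s1 * s2 * s1)); rewrite conjgE invgK !(mulgA _ _ _^-1) mulgVK.
by rewrite {1}braid !mulgA.
Qed.

Lemma s2_conj_Delta : s2 ^ (s1 * s2 * s1)^-1 = s1.
Proof.
apply: (@mulIg _ (s1 * s2 * s1)); rewrite conjgE invgK !(mulgA _ _ _^-1) mulgVK.
by rewrite {2}braid !mulgA.
Qed.

Lemma theta_cls n u :
  cls (K n) (iotaF (theta u)) = cls (K n) (iotaF u ^ (s1 * s2 * s1)^-1).
Proof.
apply: iota_conj_cls => i; congr (cls _).
case: (I2E i) => ->; rewrite -/x_F2 -/y_F2 /=.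
  by rewrite theta_x iota_x iota_y conjXg s1_conj_Delta.
by rewrite theta_y iota_x iota_y conjXg s2_conj_Delta.
Qed.

Lemma s1_conj_s12 : s1 ^ (s1 * s2)^-1 = s2.
Proof.
apply: (@mulIg _ (s1 * s2)); rewrite conjgE invgK !(mulgA _ _ _^-1) mulgVK.
by rewrite braid !mulgA.
Qed.

Lemma tau_cls n u :
  cls (K n) (iotaF (tau u)) = cls (K n) (iotaF u ^ (s1 * s2)^-1).
Proof.
apply: iota_conj_cls => i.
case: (I2E i) => ->; rewrite -/x_F2 -/y_F2 /=.
  by rewrite tau_x iota_x iota_y conjXg s1_conj_s12.
(* Both sides are the central element cc; with the right side kept as a conjugate, [cls_cc] makes it
   trivial modulo K. Hence the conjugate of y becomes (xy)^-1 = tau(y). *)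
have e : x12 * x23 * x23 ^ (s1 * s2)^-1 = cc ^ s1^-1.
  rewrite !conjgE !invgK invgM; apply: (@mulIg _ s1).
  rewrite -[x12]/(s1 * s1) -[x23]/(s2 * s2) -[cc]/(s1 * s2 * s1 * (s1 * s2 * s1)).
  rewrite {2}braid !mulgA !mulgVK mulgK.
  by rewrite -!(mulgA (s1 * s1 * s2)) braid !mulgA.
have {}e : cls (K n) x12 * cls (K n) x23 * cls (K n) (x23 ^ (s1 * s2)^-1) = 1.
  move/(congr1 (cls (K n))): e; rewrite [RHS]gmulfJ /= cls_cc conj1g => <-.
  rewrite [RHS]gmulfM; congr (_ * _).
  exact/esym/gmulfM.
transitivity ((cls (K n) x12 * cls (K n) x23)^-1).
  rewrite tau_y -invgM [iotaF _]gmulfV gmulfV; congr (_^-1).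
  by rewrite /= [iotaF _]gmulfM /= iota_x iota_y; exact: gmulfM.
by rewrite iota_y; apply: mulg1_eq.
Qed.

(** * The subgroup <r^2>^3 and the action of theta and tau on it *)

Definition rot3 n (i j k : int) : Dih n * Dih n * Dih n :=
  (dih n (2 * i)%R false, dih n (2 * j)%R false, dih n (2 * k)%R false).

Lemma rot3M n i j k i' j' k' :
  rot3 n i j k * rot3 n i' j' k' = rot3 n (i + i')%R (j + j')%R (k + k')%R.
Proof. by rewrite /rot3 mul3E !dihM !GRing.mulrDr. Qed.

Lemma rot3V n i j k : (rot3 n i j k)^-1 = rot3 n (- i)%R (- j)%R (- k)%R.
Proof. by rewrite /rot3 inv3E !dihV !GRing.mulrN. Qed.

Lemma rot3_0 n : rot3 n 0 0 0 = 1.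
Proof. by rewrite /rot3 GRing.mulr0 dih1. Qed.

Lemma rot3_expgz n i j k m :
  expgz (rot3 n i j k) m = rot3 n (i * m)%R (j * m)%R (k * m)%R.
Proof.
elim/int_ind: m => [|m IH|m IH]; first by rewrite !GRing.mulr0 rot3_0.
  have -> : (m.+1%:Z = m%:Z + 1)%R by lia.
  by rewrite expgzD IH expgz1 rot3M !GRing.mulrDr !GRing.mulr1.
have -> : (- m.+1%:Z = - m%:Z - 1)%R by lia.
by rewrite expgzD IH expgzN expgz1 rot3V rot3M !GRing.mulrBr !GRing.mulr1.
Qed.

(* The sign of k: (xy)^2 has third component r^-2. *)
Definition rotw (i j k : int) : F2 :=
  expgz (x_F2 ^+ 2) i * expgz (y_F2 ^+ 2) j * expgz ((x_F2 * y_F2) ^+ 2) (- k)%R.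

Lemma phi_xx n : phi n (x_F2 ^+ 2) = rot3 n 1 0 0.
Proof. by rewrite gmulfXn /= phi_x expgS expg1 mul3E !dihM. Qed.

Lemma phi_yy n : phi n (y_F2 ^+ 2) = rot3 n 0 1 0.
Proof. by rewrite gmulfXn /= phi_y expgS expg1 mul3E !dihM. Qed.

Lemma phi_xyxy n : phi n ((x_F2 * y_F2) ^+ 2) = rot3 n 0 0 (-1).
Proof. by rewrite gmulfXn gmulfM /= phi_x phi_y expgS expg1 !mul3E !dihM. Qed.

Lemma phi_yxyx n : phi n ((y_F2 * x_F2) ^+ 2) = rot3 n 0 0 1.
Proof. by rewrite gmulfXn gmulfM /= phi_x phi_y expgS expg1 !mul3E !dihM. Qed.

Lemma phi_rotw n i j k : phi n (rotw i j k) = rot3 n i j k.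
Proof.
rewrite /rotw !gmulfM /= !expgz_morph /= phi_xx phi_yy phi_xyxy !rot3_expgz !rot3M.
congr rot3; lia.
Qed.

Lemma phi_theta_rotw n i j k : phi n (theta (rotw i j k)) = rot3 n j i (- k)%R.
Proof.
have tx : theta (x_F2 ^+ 2) = y_F2 ^+ 2 by rewrite gmulfXn /= theta_x.
have ty : theta (y_F2 ^+ 2) = x_F2 ^+ 2 by rewrite gmulfXn /= theta_y.
have txy : theta ((x_F2 * y_F2) ^+ 2) = (y_F2 * x_F2) ^+ 2.
  by rewrite gmulfXn gmulfM /= theta_x theta_y.
rewrite /rotw !gmulfM /= !expgz_morph /= tx ty txy phi_xx phi_yy phi_yxyx.
rewrite !rot3_expgz !rot3M; congr rot3; lia.
Qed.

Lemma phi_tau_rotw n i j k : phi n (tau (rotw i j k)) = rot3 n k i j.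
Proof.
have tx : tau (x_F2 ^+ 2) = y_F2 ^+ 2 by rewrite gmulfXn /= tau_x.
have ty : tau (y_F2 ^+ 2) = ((x_F2 * y_F2) ^+ 2)^-1.
  by rewrite gmulfXn /= tau_y -invgM expVgn.
have txy : tau ((x_F2 * y_F2) ^+ 2) = (x_F2 ^+ 2)^-1.
  by rewrite gmulfXn gmulfM /= tau_x tau_y mulVKg expVgn.
rewrite /rotw !gmulfM /= !expgz_morph /= tx ty txy !gmulfV /= phi_xx phi_yy phi_xyxy.
rewrite !rot3V !rot3_expgz !rot3M; congr rot3; lia.
Qed.

(** theta descends modulo K because conjugation does. The action computed on the words [rotw]
    therefore holds for every element with the same image. *)
Lemma phi_theta_eq n u v : phi n u = phi n v -> phi n (theta u) = phi n (theta v).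
Proof.
move=> /K_clsE e; apply/K_clsE; rewrite !theta_cls [LHS]gmulfJ [RHS]gmulfJ.
by rewrite /= e.
Qed.

Lemma phi_tau_eq n u v : phi n u = phi n v -> phi n (tau u) = phi n (tau v).
Proof.
move=> /K_clsE e; apply/K_clsE; rewrite !tau_cls [LHS]gmulfJ [RHS]gmulfJ.
by rewrite /= e.
Qed.

Lemma phi_theta_rot3 n u i j k :
  phi n u = rot3 n i j k -> phi n (theta u) = rot3 n j i (- k)%R.
Proof.
by move=> e; rewrite -phi_theta_rotw; apply: phi_theta_eq; rewrite e phi_rotw.
Qed.

Lemma phi_tau_rot3 n u i j k :
  phi n u = rot3 n i j k -> phi n (tau u) = rot3 n k i j.
Proof.
by move=> e; rewrite -phi_tau_rotw; apply: phi_tau_eq; rewrite e phi_rotw.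
Qed.

(** * Coboundaries for tau and theta *)

Lemma dih_opp n a b : dih n (a + b)%R false = 1 -> dih n b false = dih n (- a)%R false.
Proof.
move=> h; have -> : b = (- a + (a + b))%R by lia.
by rewrite -(dihM n (- a)%R false (a + b)%R false) h mulg1.
Qed.

Lemma even_rot3 n a b c : ~~ odd `|a|%N -> ~~ odd `|b|%N -> ~~ odd `|c|%N ->
  exists i j k, (dih n a false, dih n b false, dih n c false) = rot3 n i j k.
Proof.
move=> ha hb hc; exists (a %/ 2)%Z, (b %/ 2)%Z, (c %/ 2)%Z.
by rewrite /rot3; congr (_, _, _); congr dih; lia.
Qed.

Lemma rot3_tau_coboundary n u i j k : phi n u = rot3 n i j k ->
  phi n (u * tau (tau u) * tau u) = 1 ->
  exists h, phi n u = phi n ((tau h)^-1 * h).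
Proof.
move=> hu; have ht := phi_tau_rot3 hu; have htt := phi_tau_rot3 ht.
rewrite !gmulfM /= hu ht htt !rot3M /rot3 => -[h _ _].
(* For h with image (p, q, t), the image of tau(h)^-1 h is (p - t, q - p, t - q). Setting t = 0
   forces p = i and q = i + j; the last entry -(i + j) agrees with k, as a power of r^2, by the
   cocycle condition. *)
exists (rotw i (i + j)%R 0); rewrite gmulfM gmulfV /= phi_tau_rotw phi_rotw rot3V rot3M.
rewrite /rot3; congr (_, _, _); try (congr dih; lia).
have -> : (2 * (- (i + j) + 0) = - (2 * (i + j)))%R by lia.
apply: dih_opp; rewrite -[RHS]h; congr dih; lia.
Qed.

(** Two stages along the extension of (Z/2)^2 by <r^2>^3: a twist by w moves u into <r^2>^3,
    [rot3_tau_coboundary] applies there, and the twist is undone. *)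
Lemma tau_coboundary n u : phi n (u * tau (tau u) * tau u) = 1 ->
  exists h, phi n u = phi n ((tau h)^-1 * h).
Proof.
move=> hu.
(* w makes tau(w) u w^-1 trivial in (Z/2)^2. *)
have [w [i [j [k hw]]]] : exists w i j k, phi n (tau w * u * w^-1) = rot3 n i j k.
  have [a [b [c [d [e [hs ha hb hc]]]]]] := phi_shape n u.
  have rotE w : phi n (tau w * u * w^-1) = phi n (tau w) * phi n u * (phi n w)^-1.
    by rewrite !gmulfM /= gmulfV.
  (* On (Z/2)^2 the map w -> tau(w) w^-1 sends x, y, xy to the classes of xy, x, y; this gives one w
     for each pair (d, e). *)
  move: hs ha hb hc; case: d; case: e => /= hs ha hb hc.
  - exists x_F2; rewrite rotE tau_x phi_x phi_y hs.
    by rewrite !(mul3E, inv3E, dihV, dihM); apply: even_rot3 => /=; lia.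
  - exists y_F2; rewrite rotE tau_y gmulfM !gmulfV /= phi_x phi_y hs.
    by rewrite !(mul3E, inv3E, dihV, dihM); apply: even_rot3 => /=; lia.
  - exists (x_F2 * y_F2); rewrite rotE.
    have -> : tau (x_F2 * y_F2) = x_F2^-1 by rewrite gmulfM /= tau_x tau_y mulVKg.
    have -> : phi n (x_F2 * y_F2) = phi n x_F2 * phi n y_F2 by exact: gmulfM.
    rewrite gmulfV /= phi_x phi_y hs.
    by rewrite !(mul3E, inv3E, dihV, dihM); apply: even_rot3 => /=; lia.
  - by exists 1; rewrite gmulf1 mul1g invg1 mulg1 hs; apply: even_rot3; lia.
(* Since tau^3 = 1, the factors coming from w telescope and leave a conjugate of the original
   product. *)
have hc : phi n (tau w * u * w^-1 * tau (tau (tau w * u * w^-1)) *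
                 tau (tau w * u * w^-1)) = 1.
  have -> : tau w * u * w^-1 * tau (tau (tau w * u * w^-1)) *
      tau (tau w * u * w^-1) = (u * tau (tau u) * tau u) ^ (tau w)^-1.
    rewrite ?(gmulfM, gmulfV) /= ?(gmulfM, gmulfV) /= tauK conjgE.
    by rewrite !gnorm.
  by rewrite gmulfJ /= hu conj1g.
have [h hh] := rot3_tau_coboundary hw hc.
exists (h * w).
have -> : (tau (h * w))^-1 * (h * w) = (tau w)^-1 * ((tau h)^-1 * h) * w.
  by rewrite gmulfM /= invgM !mulgA.
transitivity (phi n ((tau w)^-1 * (tau w * u * w^-1) * w)).
  by rewrite !gnorm.
rewrite [LHS]gmulfM [RHS]gmulfM; congr (_ * _).
by rewrite [LHS]gmulfM [RHS]gmulfM /= hh.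
Qed.

(** Commutators in D_n lie in <r^2> by [dih_comm], so the classes with image in <r^2>^3 form one of
    the subgroups whose intersection is the commutator subgroup. *)
Lemma commutator_rot3 n f : commutator_subgroup (cls (NF2 (K n)) f) ->
  exists i j k, phi n f = rot3 n i j k.
Proof.
pose H : {pred quo (NF2 (K n))} := fun z =>
  `[< exists u i j k, cls (NF2 (K n)) u = z /\ phi n u = rot3 n i j k >].
have HE z : (z \in H) =
  `[< exists u i j k, cls (NF2 (K n)) u = z /\ phi n u = rot3 n i j k >] by [].
move=> /(_ H) hf; suff : cls (NF2 (K n)) f \in H.
  rewrite HE => /asboolP[u [i] [j] [k] [/NF2_clsE <- hu]]; by exists i, j, k.
apply: hf.
  split.
    by rewrite HE; apply/asboolP; exists 1, 0%R, 0%R, 0%R; rewrite !gmulf1 rot3_0.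
  move=> z z'; rewrite !HE => /asboolP[u [i] [j] [k] [<- hu]].
  move=> /asboolP[u' [i'] [j'] [k'] [<- hu']]; apply/asboolP.
  exists (u / u'), (i - i')%R, (j - j')%R, (k - k')%R.
  by rewrite !gmulfF /= hu hu' rot3V rot3M.
move=> z z'; rewrite HE -(cls_repr z) -(cls_repr z').
set u := repr z; set u' := repr z'; apply/asboolP.
have [a [b [c [d [e [hu _ _ _]]]]]] := phi_shape n u.
have [a' [b' [c' [d' [e' [hu' _ _ _]]]]]] := phi_shape n u'.
have : phi n [~ u, u'] = (([~ dih n a e, dih n a' e'], [~ dih n b d, dih n b' d']),
  [~ dih n c (d (+) e), dih n c' (d' (+) e')]).
  by rewrite gmulfR /= hu hu'.
(* The three half exponents are read off [dih_comm] by unification. *)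
rewrite !dih_comm => hc; exists [~ u, u']; do 3!eexists; split; last exact: hc.
exact: gmulfR.
Qed.

Lemma rot3_theta_coboundary n f i j k : phi n f = rot3 n i j k ->
  phi n (theta f * f) = 1 -> exists g, phi n f = phi n ((theta g)^-1 * g).
Proof.
move=> hf; have ht := phi_theta_rot3 hf.
rewrite gmulfM /= ht hf rot3M => -[h _ _].
have {}h : dih n (2 * j)%R false = dih n (2 * - i)%R false.
  by rewrite GRing.mulrN; apply: dih_opp; rewrite -[RHS]h; congr dih; lia.
have -> : rot3 n i j k = rot3 n i (- i)%R k by rewrite /rot3 h.
(* For g with image (p, q, t), theta(g)^-1 g has image (p - q, q - p, 2t), which settles even k. *)
have [e|e] : k = (2 * (k %/ 2)%Z)%R \/ k = (2 * ((k + 1) %/ 2)%Z - 1)%R by lia.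
  exists (rotw i 0 (k %/ 2)%Z).
  rewrite gmulfM gmulfV /= phi_theta_rotw phi_rotw rot3V rot3M; congr rot3; lia.
(* For odd k, theta(xy)^-1 xy contributes (-1, 1, -1), and w supplies the remaining (i + 1, -(i +
   1), k + 1). *)
set w := rotw (i + 1)%R 0 ((k + 1) %/ 2)%Z; exists (x_F2 * y_F2 * w).
have hxy : phi n ((y_F2 * x_F2)^-1 * (x_F2 * y_F2)) = rot3 n (-1) 1 (-1).
  rewrite gmulfM gmulfV !gmulfM /= phi_x phi_y !(mul3E, inv3E, dihV, dihM).
  by [].
have -> : (theta (x_F2 * y_F2 * w))^-1 * (x_F2 * y_F2 * w) =
    (theta w)^-1 * ((y_F2 * x_F2)^-1 * (x_F2 * y_F2)) * w.
  by rewrite !gmulfM /= theta_x theta_y !invgM !mulgA.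
rewrite 2!gmulfM /= gmulfV /= hxy phi_theta_rotw phi_rotw rot3V !rot3M; congr rot3; lia.
Qed.

(** * From hexagons to cocycle conditions in an abstract group *)

(** Here a, b, F, P, Q stand for s1, s2, f, x^m, y^m in B3/K. Multiplying the first hexagon by P a
    and inserting the second gives F^-1 D = D F, the theta-condition. This yields F^-1 Q = D F P D,
    which turns the first hexagon into the tau-condition. *)
Lemma hexagon_cocycles (G : groupType) (a b F P Q : G) :
  a * b * a = b * a * b -> (a * b * a) ^+ 2 = 1 ->
  P * a = a * P -> P * (b * a) = b * a * Q ->
  a * P * F^-1 * (Q * b) * F = F^-1 * a * b * P^-1 ->
  F^-1 * (Q * b) * F * (P * a) = b * a * Q^-1 * F ->
  F ^ (a * b * a)^-1 * F = 1 /\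
  F * P * ((F * P) ^ (a * b)^-1) ^ (a * b)^-1 * (F * P) ^ (a * b)^-1 = 1.
Proof.
set D := a * b * a => br D2 Pa Pba h1 h2.
have {}D2 : D * D = 1 by rewrite -D2 expgS.
have e : F^-1 * D = D * F.
  transitivity (F^-1 * a * b * P^-1 * (P * a)); first by rewrite !mulgA mulgVK.
  transitivity (a * P * (F^-1 * (Q * b) * F * (P * a))); first by rewrite -h1 !mulgA.
  by rewrite h2 -(mulgA _ Q^-1) -!(mulgA a P) (mulgA P) Pba !mulgA mulgK.
split; first by rewrite conjgE invgK mulgA -e mulgK mulVg.
have h : F * P * (a * (F^-1 * Q) * b) * (F * P) * (a * b)^-1 = 1.
  transitivity (F * (a * P * F^-1 * (Q * b) * F) * P * (a * b)^-1).
    by rewrite -Pa !mulgA.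
  by rewrite h1 !mulgA mulgV mul1g mulgVK mulgV.
have PD : P * D = D * Q.
  by rewrite /D -(mulgA a b a) -[RHS]mulgA -Pba !mulgA Pa.
have aD : a * D = (a * b)^-1 by apply/esym/mulg1_eq; rewrite -D2 /D !mulgA.
have Db : D * b = (a * b)^-1.
  by apply: (@mulIg _ (a * b)); rewrite mulVg -D2 -mulgA [b * _]mulgA -br.
have T2 : (a * b)^-1^-1 * (a * b)^-1^-1 = (a * b)^-1.
  by rewrite invgK -aD br !mulgA.
clearbody D.
have FQ : F^-1 * Q = D * (F * P) * D.
  by rewrite !mulgA -e -!mulgA PD (mulgA D) D2 mul1g.
(* With U = F P and T = a b, the first hexagon becomes (U T^-1)^3 = 1. As T^2 = T^-1, this is the
   tau-condition expanded. *)
move: h; rewrite FQ; move: (F * P) (a * b) aD Db T2 => U T aD Db T2.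
have -> : a * (D * U * D) * b = T^-1 * U * T^-1 by rewrite -{1}aD -Db !mulgA.
move=> <-; rewrite !conjgE -!mulgA mulVKg; congr (_ * _).
by rewrite mulgA T2.
Qed.

(** * Divisibility of the order by 3 and dependence on m *)

(* r is sent to a 3-cycle of S_3, which transpositions invert. *)
Lemma dvd3_rr n k : (3 %| n)%N -> rr n ^+ k = 1 -> (3 %| k)%N.
Proof.
move=> n3 h.
pose a := braid_perm (s1 * s2); pose t := braid_perm s1.
have t2 : t * t = 1 by rewrite /t braid_perm_s1 tperm2.
have t2' : braid_perm s2 * braid_perm s2 = 1 by rewrite braid_perm_s2 tperm2.
have aE : a = t * braid_perm s2 by rewrite /a gmulfM.
have ta : t * a = braid_perm s2 by rewrite aE mulgA t2 mul1g.
have a3 : a ^+ 3 = 1.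
  by rewrite /a -gmulfXn s12_3; apply/eqP; exact: cc_PB3.
have an : a ^+ n = 1 by rewrite -(divnK n3) mulnC expgnA a3 expg1n.
have tata : t * a * t * a = 1 by rewrite -mulgA ta t2'.
have hm := @lift_morphism _ _ _ _ (D_lift an t2 tata).
pose L : UMagmaMorphism.type (Dih n) 'S_3 :=
  HB.pack (plift (pair2 a t)) (isUMagmaMorphism.Build (Dih n) 'S_3 _ hm).
have ak : a ^+ k = 1.
  have <- : L (rr n) = a by exact: (lift_gen (D_lift an t2 tata)).
  by rewrite -gmulfXn h gmulf1.
have a1 : a <> 1 by move/(@perm_transversal Cab).
rewrite /dvdn; have : (k %% 3 < 3)%N by rewrite ltn_mod.
move: ak; rewrite {1}(divn_eq k 3) expgnDr mulnC expgnA a3 expg1n mul1g.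
case: (k %% 3)%N => [|[|[|//]]] //.
by move=> a2; case: a1; move: a3; rewrite expgS a2 mulg1.
Qed.

(** The order of x12 modulo K is already divisible by 3, since its first component is r. *)
Lemma dvd3_Nord n : (3 %| n)%N -> (3 %| Nord (K n))%N.
Proof.
move=> n3; apply: dvdn_trans (dvdn_lcml _ _); apply: dvdn_trans (dvdn_lcml _ _).
have := ordg_expg (cls (K n) x12); set k := ordg _ => h.
have : phi n (x_F2 ^+ k) = 1.
  by apply/phi_eq1; rewrite [iotaF _]gmulfXn /= iota_x gmulfXn /= h.
rewrite gmulfXn /= phi_x => /(congr1 (fun p => p.1.1)) /=.
have -> : ((dih n 1 false, dih n 0 true, dih n 0 true) ^+ k).1.1 = rr n ^+ k.
  rewrite 2!gmulfXn /= /dih expgz1 mulg1; done.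
exact: dvd3_rr.
Qed.

(** The order of x modulo K divides [Nord], so the class of f x^m depends only on the shadow. *)
Lemma phi_expgz_Nord n m m' : (m = m' %[mod Nord (K n)])%Z ->
  phi n (expgz x_F2 m) = phi n (expgz x_F2 m').
Proof.
set N := Nord _ => e.
have -> : m = (m' + N%:Z * ((m %/ N)%Z - (m' %/ N)%Z))%R.
  by rewrite {1}(divz_eq m N) e {2}(divz_eq m' N); lia.
rewrite expgzD gmulfM /= expgz_natM.
have -> : phi n (expgz (x_F2 ^+ N) ((m %/ N)%Z - (m' %/ N)%Z)%R) = 1.
  rewrite expgz_morph /=.
  suff -> : phi n (x_F2 ^+ N) = 1 by rewrite expg1z.
  apply/phi_eq1; rewrite [iotaF _]gmulfXn /= iota_x gmulfXn /=.
  have : (ordg (cls (K n) x12) %| N)%N.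
    by apply: dvdn_trans (dvdn_lcml _ _); apply: dvdn_lcml.
  by move=> /dvdnP[q ->]; rewrite mulnC expgnA ordg_expg expg1n.
by rewrite mulg1.
Qed.

(** * The hexagons and the residue of m modulo 3 *)

(** In B3/K the element c is trivial and s1^(2m+1) = x^m s1, so [hexagon_cocycles] applies;
    [theta_cls] and [tau_cls] turn its conjugations into theta and tau. *)
Lemma hexagon_phi n m f : hexagon (K n) m f ->
  phi n (theta f * f) = 1 /\
  phi n (f * expgz x_F2 m * tau (tau (f * expgz x_F2 m)) * tau (f * expgz x_F2 m)) = 1.
Proof.
pose q := cls (K n); pose a := q s1; pose b := q s2; pose F := q (iotaF f).
pose P := expgz (a ^+ 2) m; pose Q := expgz (b ^+ 2) m.
have qM u v : q (u * v) = q u * q v by exact: gmulfM.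
have qV u : q u^-1 = (q u)^-1 by exact: gmulfV.
have qZ u k : q (expgz u k) = expgz (q u) k by exact: expgz_morph.
have qX u k : q (u ^+ k) = q u ^+ k by exact: gmulfXn.
have aX : expgz a (2 * m + 1)%R = P * a by rewrite expgzD expgz1 expgz_natM.
have bX : expgz b (2 * m + 1)%R = Q * b by rewrite expgzD expgz1 expgz_natM.
have Pa : P * a = a * P.
  by rewrite -aX GRing.addrC expgzD expgz1 expgz_natM.
have br : a * b * a = b * a * b by move/(congr1 q): braid; rewrite !qM.
have D2 : (a * b * a) ^+ 2 = 1 by move: (cls_cc n); rewrite -/q /cc qX !qM.
have Pba : P * (b * a) = b * a * Q.
  apply: expgz_intertwine; rewrite !expgS expg0 !mulg1.
  transitivity (a * (a * b * a)); first by rewrite !mulgA.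
  by rewrite br !mulgA br.
case; rewrite -!/(q _).
rewrite !(qM, qV, qZ, qX) -/a -/b -/F aX bX !expgzN.
rewrite -[a * a]/(a ^+ 2) -[b * b]/(b ^+ 2) -[a * b * a * (_ * _)]/((a * b * a) ^+ 2).
rewrite D2 expg1z !mulg1 -/P -/Q.
move=> h1 h2.
have [|e1 e2] := hexagon_cocycles br D2 Pa Pba _ h2.
  by rewrite -h1 -Pa !mulgA.
have fE : q (iotaF (f * expgz x_F2 m)) = F * P.
  by rewrite [iotaF _]gmulfM qM expgz_morph qZ /= iota_x qX.
have thE u : q (iotaF (theta u)) = q (iotaF u) ^ (a * b * a)^-1.
  by rewrite /q theta_cls [LHS]gmulfJ /= -/q qV !qM.
have taE u : q (iotaF (tau u)) = q (iotaF u) ^ (a * b)^-1.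
  by rewrite /q tau_cls [LHS]gmulfJ /= -/q qV !qM.
have iM u v : q (iotaF (u * v)) = q (iotaF u) * q (iotaF v).
  by rewrite [iotaF _]gmulfM qM.
split; apply/phi_eq1; rewrite -/q; first by rewrite iM thE.
by rewrite !iM !taE !iM -[q _ * q _]iM fE.
Qed.

(** If m = 1 mod 3, then 3 would divide both 2m + 1 and [Nord]. *)
Lemma coprime_mod3 n (m : int) : (3 %| n)%N ->
  coprimez (2 * m + 1)%R (Nord (K n)) ->
  (m = 0 %[mod 3])%Z \/ (m = - 1 %[mod 3])%Z.
Proof.
move=> n3; rewrite /coprimez /gcdz => /eqP[] co.
have : ~~ (3 %| `|(2 * m + 1)%R|)%N.
  apply/negP => h; have := dvdn_gcd 3 `|(2 * m + 1)%R| (Nord (K n)).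
  by rewrite co h dvd3_Nord.
lia.
Qed.

(** * Coboundary form of a GT-shadow *)

Unset Implicit Arguments.
Set Strict Implicit.

Theorem theorem5p2 (n : nat) (n_gt0 : (0 < n)%N) (n_dvd3 : (3 %| n)%N)
    (m : int) (f : F2) :
  GT (K n) (shadow (K n) m f) ->
  exists g h : F2,
    cls (NF2 (K n)) f = cls (NF2 (K n)) ((theta g)^-1 * g) /\
    (((m = 0 %[mod 3])%Z /\
      cls (NF2 (K n)) (f * expgz x_F2 m) = cls (NF2 (K n)) ((tau h)^-1 * h)) \/
     ((m = - 1 %[mod 3])%Z /\
      cls (NF2 (K n)) (f * expgz x_F2 m)
        = cls (NF2 (K n)) ((tau h)^-1 * (x_F2 * y_F2) * h))).
Proof.
(* Membership in [GT] only provides some representative (m', f') of the shadow; the conclusions are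
   carried back to (m, f). *)
case=> m' [f' [e hex co comm _]].
case: e => em /NF2_clsE ef.
(* The two residue classes are equal as sets, and m lies in the first. *)
have {}em : (m = m' %[mod Nord (K n)])%Z.
  by move/(congr1 (fun A : int -> Prop => A m)): em => /= <-.
have em3 : (m = m' %[mod 3])%Z.
  have /dvdnP[d hd] := dvd3_Nord n_dvd3.
  move/eqP: em; rewrite eqz_mod_dvd hd => /dvdzP[c hc].
  apply/eqP; rewrite eqz_mod_dvd; apply/dvdzP; exists (c * d%:Z)%R; rewrite hc; lia.
have [hth htau] := hexagon_phi hex.
have [i [j [k hrot]]] := commutator_rot3 comm.
have [g hg] := rot3_theta_coboundary hrot hth.
have [h hh] := tau_coboundary htau.
have efx : phi n (f * expgz x_F2 m) = phi n ((tau h)^-1 * h).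
  by rewrite -hh [LHS]gmulfM [RHS]gmulfM /= ef (phi_expgz_Nord em).
exists g.
have hfg : cls (NF2 (K n)) f = cls (NF2 (K n)) ((theta g)^-1 * g).
  by apply/NF2_clsE; rewrite ef.
have [m0|m1] := coprime_mod3 n_dvd3 co.
  exists h; split=> //; left; split; first by rewrite em3.
  exact/NF2_clsE.
(* xy is itself a tau-cocycle, as xy . y^-1 . x^-1 = 1, hence modulo K it is tau(w)^-1 w. Replacing
   h by w^-1 h then inserts xy into tau(h)^-1 h. *)
have [w hw] : exists w, phi n (x_F2 * y_F2) = phi n ((tau w)^-1 * w).
  apply: tau_coboundary.
  have -> : tau (x_F2 * y_F2) = x_F2^-1 by rewrite gmulfM /= tau_x tau_y mulVKg.
  by rewrite gmulfV /= tau_x mulgK mulgV gmulf1.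
exists (w^-1 * h); split=> //; right; split; first by rewrite em3.
apply/NF2_clsE; rewrite efx.
transitivity (phi n ((tau (w^-1 * h))^-1 * ((tau w)^-1 * w) * (w^-1 * h))).
  have -> : tau (w^-1 * h) = (tau w)^-1 * tau h by rewrite gmulfM gmulfV.
  by rewrite !gnorm.
rewrite [LHS]gmulfM [RHS]gmulfM; congr (_ * _).
by rewrite [LHS]gmulfM [RHS]gmulfM /= hw.
Qed.
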